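(* Let $\mathcal{M}=(M_2(\mathbb{C}),\frac12 Tr)*(M_2(\mathbb{C}),\frac12 Tr)$ with its faithful normal trace $\tau$, and let $\mathfrak{A}_3\subseteq\mathcal{B}(L^2(\mathcal{M},\tau))$ be the algebra generated by $E_{11}$, $F_{12}$ and $\mathcal{M}'$. Then $\mathfrak{A}_3$ is not a transitive algebra. Indeed, for any $0\leq r\leq 1$ there is a projection $E_r\in\mathcal{M}$ such that $\tau(E_r)=r$ and $E_r\in \mathrm{Lat}\,\mathfrak{A}_3$.
   Context: $\mathcal{M}$ is the reduced free product von Neumann algebra of two copies of $M_2(\mathbb{C})$ with respect to the normalized trace $\frac12 Tr$; it is a type $II_1$ factor with faithful normal trace $\tau$. $(E_{ij})_{i,j=1,2}$ and $(F_{ij})_{i,j=1,2}$ are the standard matrix units of the first copy $(M_2(\mathbb{C}),\frac12 Tr)*1$ and of the second copy $1*(M_2(\mathbb{C}),\frac12 Tr)$ inside $\mathcal{M}$, respectively. $\mathcal{M}$ acts on $L^2(\mathcal{M},\tau)$ by left multiplication and $\mathcal{M}'$ is its commutant. ''Algebra generated'' means the (not necessarily self-adjoint or closed) algebra generated. A subalgebra of $\mathcal{B}(\mathcal{H})$ is transitive if it contains the identity and has no invariant closed subspaces other than $\{0\}$ and $\mathcal{H}$. For a projection $P$ and a set $\mathfrak{A}$ of operators, $P\in\mathrm{Lat}\,\mathfrak{A}$ means the range of $P$ is invariant under every $T\in\mathfrak{A}$, i.e. $PTP=TP$ for all $T\in\mathfrak{A}$. *)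

(* Defs.v *)
From HB Require Import structures.
From mathcomp Require Import all_boot all_order all_algebra.
From mathcomp Require Import complex sesquilinear.
From mathcomp Require Import all_classical all_reals all_analysis.

Set Implicit Arguments.
Unset Strict Implicit.
Unset Printing Implicit Defensive.

Import Order.TTheory GRing.Theory Num.Theory.
Import numFieldNormedType.Exports.

Local Open Scope classical_set_scope.
Local Open Scope ring_scope.
Local Open Scope complex_scope.

(* A complex Hilbert space is a complete normed space H over R[i] together
   with a positive definite Hermitian form, linear in its first argument, that
   induces the norm.  Operators are plain functions H -> H, so that sums and
   scalar multiples are the pointwise ones; the product is composition. *)

Section Operators.
Context {R : realType} {H : completeNormedModType R[i]}.
Variable ip : {dot H for Num.conj}.
Implicit Types (S T P : H -> H) (A M : set (H -> H)) (K : set H).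

Definition hilbert_norm : Prop := forall x : H, `|x| ^+ 2 = ip x x.

Definition bounded_op T : Prop := linear T /\ continuous T.

Definition adjoint_of T S : Prop := forall x y : H, ip (T x) y = ip x (S y).

Definition is_projection P : Prop :=
  [/\ bounded_op P, P \o P = P & adjoint_of P P].

Definition commutant A : set (H -> H) :=
  [set T | bounded_op T /\ forall S, A S -> T \o S = S \o T].

Definition subalgebra A : Prop :=
  [/\ A `<=` bounded_op,
      A 0,
      forall S T, A S -> A T -> A (S + T),
      forall (c : R[i]) T, A T -> A (c *: T)
    & forall S T, A S -> A T -> A (S \o T)].

Definition generated_algebra A : set (H -> H) := smallest subalgebra A.

Definition closed_subspace K : Prop :=
  [/\ closed K, K 0 & forall (c : R[i]) x y, K x -> K y -> K (c *: x + y)].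

Definition transitive_algebra A : Prop :=
  A idfun /\
  forall K, closed_subspace K -> (forall T x, A T -> K x -> K (T x)) ->
    K = [set 0] \/ K = setT.

Definition Lat A : set (H -> H) :=
  [set P | is_projection P /\ forall T, A T -> P \o T \o P = T \o P].

(* H is L^2(M, tau) with M acting by left multiplication: xi stands for the
   class of 1, T |-> T xi is the canonical embedding of M, and <S, T> =
   tau (T^* S).  A vector state is automatically positive and normal. *)
Record L2_representation M (tau : (H -> H) -> R[i]) (xi : H) : Prop := {
  L2_unit : ip xi xi = 1;
  L2_state : forall T, M T -> tau T = ip (T xi) xi;
  L2_cyclic : closure [set T xi | T in M] = setT }.

Record faithful_trace M (tau : (H -> H) -> R[i]) : Prop := {
  trace_tracial : forall S T, M S -> M T -> tau (S \o T) = tau (T \o S);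
  trace_faithful : forall S T, M S -> M T -> adjoint_of S T ->
    tau (T \o S) = 0 -> S = 0 }.

(* Voiculescu's freeness: a product of tau-centred elements taken from
   subalgebras with distinct neighbouring indices is tau-centred. *)
Definition free_family (I : eqType) (tau : (H -> H) -> R[i])
    (A : I -> set (H -> H)) : Prop :=
  forall (n : nat) (i : nat -> I) (T : nat -> H -> H),
    (0 < n)%N ->
    (forall k, (k < n)%N -> A (i k) (T k) /\ tau (T k) = 0) ->
    (forall k, (k.+1 < n)%N -> i k != i k.+1) ->
    tau (\big[(fun S S' => S \o S')/idfun]_(0 <= k < n) T k) = 0.

Record unital_star_morphism (p : 'M[R[i]]_2 -> H -> H) : Prop := {
  star_bounded : forall a, bounded_op (p a);
  star_linear : linear p;
  star_one : p 1%:M = idfun;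
  star_mul : forall a b, p (a *m b) = p a \o p b;
  star_adjoint : forall a, adjoint_of (p a) (p (map_mx Num.conj a^T)) }.

(* (M, tau) is the reduced free product (M_2(C), Tr/2) * (M_2(C), Tr/2), in
   its standard form on H = L^2(M, tau); emb false and emb true embed the first
   and the second copy of M_2(C).  These conditions determine the whole
   structure up to unitary equivalence.  The generating set is self-adjoint,
   hence the von Neumann algebra it generates is its bicommutant. *)
Record free_product_M2 M (tau : (H -> H) -> R[i]) (xi : H)
    (emb : bool -> 'M[R[i]]_2 -> H -> H) : Prop := {
  fp_hilbert : hilbert_norm;
  fp_morphism : forall b, unital_star_morphism (emb b);
  fp_state : forall b a, tau (emb b a) = 2^-1 * \tr a;
  fp_free : free_family tau (fun b => range (emb b));
  fp_generated : M = commutant (commutant (\bigcup_b range (emb b)));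
  fp_L2 : L2_representation M tau xi;
  fp_trace : faithful_trace M tau }.

End Operators.

(* Main.v *)
(* Let U = E_11 - E_22, Z = F_11 - F_22, X = F_12 + F_21, V = U Z and
   T = X (V - V^-1).  T commutes with Z, and F_12 U = T / 2 on the range of F_11,
   so it suffices to find a projection of M commuting with Z whose range is
   T-invariant.  T is R-diagonal, and for 0 < t < 1, with
   w_n = (1 - t) / t * ((1 + t) / (4 t))^n, the operators
   X_n = (1 + w_n T^*n T^n)^-1 of M form a martingale of trace t.  Indeed freeness
   provides a closed subspace W of L^2(M), containing xi, whose translates V^k W
   are pairwise orthogonal and such that X V^k W is contained in W for k <> 0; on
   W the operator X_(n+1) is a geometric series of alternating words in V^2 - and
   X X_n X - centred elements, whence
     <X_n w, X_m w'> = (t^2 + v_min(n, m)) <w, w'>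
   where v_0 = 0 and v_(n+1) is the image of v_n under a parabolic Moebius map
   with fixed point t (1 - t).  Hence X_n xi is Cauchy and, M being finite, X_n
   converges strongly; as v_n tends to t - t^2 the limit is a projection P of
   trace t, and w_n T^*n T^n X_n = 1 - X_n makes its range T-invariant.  An
   E_11- and F_12-invariant subspace is then obtained from the range of F_11 P
   with the identity tr (ker B) = tr (ker B^* ). *)
Require Import Defs.
From HB Require Import structures.
From mathcomp Require Import all_boot all_order all_algebra.
From mathcomp Require Import complex sesquilinear.
From mathcomp Require Import all_classical all_reals all_analysis.
From mathcomp Require Import ring lra.

Set Implicit Arguments.
Unset Strict Implicit.
Unset Printing Implicit Defensive.

Import Order.TTheory GRing.Theory Num.Theory.
Import numFieldNormedType.Exports.
Local Open Scope classical_set_scope.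
Local Open Scope ring_scope.
Local Open Scope complex_scope.

(** A single operator suffices for the following reason. An E_11-invariant subspace is also
    U-invariant, and the words F_12 U F_12 U ... that it must absorb act on the range of F_11 as
    powers of T / 2. The weights w_n come from free probability. The operator T^*T = 2 - V^2 - V^-2
    has the arcsine law on [0, 4], whose S-transform is s(u) = (u + 2) / (4 (u + 1)). As T is
    R-diagonal, T^*n T^n has S-transform s^n, and the equation tau ((1 + w T^*n T^n)^-1) = t has the
    solution w = (1 - t) / t * s(t - 1)^n with s(t - 1) = (1 + t) / (4 t). Heuristically P is
    therefore the spectral projection of lim (T^*n T^n)^(1/n) for [0, 4 t / (1 + t)], the subspace
    attached by Haagerup and Schultz to a disc. Resolvents of constant trace replace this spectral
    limit by computations with inner products: t - t^2 is the variance of a projection of trace t,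
    so the limit is idempotent exactly because the covariances climb to that value. *)

Section Hilbert.
Context {R : realType} {H : completeNormedModType R[i]}.
Variable ip : {dot H for Num.conj}.
Hypothesis hn : hilbert_norm ip.
Implicit Types (x y z u v w : H) (S T A B P : H -> H) (K : set H).

(** * Inner product and real-valued norm *)

Lemma ipDl x y z : ip (x + y) z = ip x z + ip y z.
Proof. exact: linearDl. Qed.
Lemma ipDr x y z : ip x (y + z) = ip x y + ip x z.
Proof. exact: linearDr. Qed.
Lemma ipNl x y : ip (- x) y = - ip x y.
Proof. exact: linearNl. Qed.
Lemma ipNr x y : ip x (- y) = - ip x y.
Proof. exact: linearNr. Qed.
Lemma ipBl x y z : ip (x - y) z = ip x z - ip y z.
Proof. exact: linearBl. Qed.
Lemma ipBr x y z : ip x (y - z) = ip x y - ip x z.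
Proof. exact: linearBr. Qed.
Lemma ip0l x : ip 0 x = 0.
Proof. exact: linear0l. Qed.
Lemma ip0r x : ip x 0 = 0.
Proof. exact: linear0r. Qed.
Lemma ipZl (c : R[i]) x y : ip (c *: x) y = c * ip x y.
Proof. exact: linearZl_LR. Qed.
Lemma ipZr (c : R[i]) x y : ip x (c *: y) = Num.conj c * ip x y.
Proof. exact: linearZr_LR. Qed.
Lemma ipC x y : ip x y = Num.conj (ip y x).
Proof. by rewrite [LHS]hermC expr0 mul1r. Qed.

Lemma conj_rc (r : R) : Num.conj (r%:C : R[i]) = r%:C.
Proof. by rewrite conj_Creal // complex_real. Qed.

(** Norms take values in [R[i]]; [cab] and [nrm] bring them to the totally ordered field [R]. *)
Definition cab (c : R[i]) : R := complex.Re `|c|.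
Definition nrm x : R := complex.Re `|x|.

Lemma cabE c : `|c| = (cab c)%:C.
Proof. by rewrite /cab RRe_real ?normr_real. Qed.
Lemma nrmE x : `|x| = (nrm x)%:C.
Proof. by rewrite /nrm RRe_real ?normr_real. Qed.
Lemma cab_ge0 c : 0 <= cab c.
Proof. by rewrite -lecR -cabE; exact: normr_ge0. Qed.
Lemma nrm_ge0 x : 0 <= nrm x.
Proof. by rewrite -lecR -nrmE; exact: normr_ge0. Qed.
Lemma nrm0 : nrm 0 = 0.
Proof. by apply: complexI; rewrite -nrmE normr0. Qed.
Lemma nrm_eq0 x : nrm x = 0 -> x = 0.
Proof. by move=> h; apply/normr0_eq0; rewrite nrmE h. Qed.
Lemma nrmD x y : nrm (x + y) <= nrm x + nrm y.
Proof. by rewrite -lecR rmorphD /= -!nrmE ler_normD. Qed.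
Lemma nrmN x : nrm (- x) = nrm x.
Proof. by apply: complexI; rewrite -!nrmE normrN. Qed.
Lemma nrmB x y : nrm (x - y) <= nrm x + nrm y.
Proof. by rewrite -(nrmN y) nrmD. Qed.
Lemma nrmBC x y : nrm (x - y) = nrm (y - x).
Proof. by rewrite -nrmN opprB. Qed.
Lemma nrmZ c x : nrm (c *: x) = cab c * nrm x.
Proof. by apply: complexI; rewrite rmorphM /= -!nrmE -cabE normrZ. Qed.
Lemma cabD (c d : R[i]) : cab (c + d) <= cab c + cab d.
Proof. by rewrite -lecR rmorphD /= -!cabE ler_normD. Qed.
Lemma cab_rc (r : R) : cab r%:C = `|r|.
Proof. by rewrite /cab normc_def /= expr0n addr0 sqrtr_sqr. Qed.
Lemma cab_eq0 c : cab c = 0 -> c = 0.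
Proof. by move=> h; apply/normr0_eq0; rewrite cabE h. Qed.
Lemma nrmZr (r : R) x : 0 <= r -> nrm (r%:C *: x) = r * nrm x.
Proof. by move=> r0; rewrite nrmZ cab_rc ger0_norm. Qed.
Lemma le_cab (c : R[i]) : `|complex.Re c| <= cab c.
Proof. by rewrite -lecR -cabE normc_ge_Re. Qed.

Lemma ip_nrm x : ip x x = (nrm x ^+ 2)%:C.
Proof. by rewrite rmorphXn /= -nrmE hn. Qed.
Lemma nrm2 x : nrm x ^+ 2 = complex.Re (ip x x).
Proof. by rewrite ip_nrm. Qed.
Lemma ip_eq0 x : ip x x = 0 -> x = 0.
Proof.
rewrite ip_nrm => /eqP; rewrite (_ : 0 = 0%:C)// => /eqP /complexI /eqP.
by rewrite sqrf_eq0 => /eqP /nrm_eq0.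
Qed.

(** Used twice: nonnegativity of the left side is Cauchy-Schwarz, and minimality of a distance
    forces the subtracted term to vanish. *)
Lemma nrm_sub_proj x y : nrm y != 0 ->
  nrm (x - (ip x y / ip y y) *: y) ^+ 2 = nrm x ^+ 2 - cab (ip x y) ^+ 2 / nrm y ^+ 2.
Proof.
move=> y0; have yy0 : ip y y != 0.
  by apply: contra_neq y0 => /ip_eq0 ->; exact: nrm0.
apply: complexI; rewrite -ip_nrm.
rewrite rmorphB fmorph_div !rmorphXn /= -!nrmE -cabE !hn.
rewrite ipBl !ipBr !ipZl !ipZr rmorphM /= fmorphV /=.
rewrite -(ipC y y) -(ipC y x) normCK -(ipC y x).
by field.
Qed.

Lemma CS x y : cab (ip x y) <= nrm x * nrm y.
Proof.
have [y0|y0] := eqVneq (nrm y) 0.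
  by rewrite y0 (nrm_eq0 y0) ip0r /cab normr0 /= mulr0.
have yp : 0 < nrm y by rewrite lt_neqAle eq_sym y0 nrm_ge0.
have : 0 <= nrm x ^+ 2 - cab (ip x y) ^+ 2 / nrm y ^+ 2.
  by rewrite -(nrm_sub_proj x y0) sqr_ge0.
rewrite subr_ge0 ler_pdivrMr ?exprn_gt0// -exprMn.
by rewrite ler_sqr ?nnegrE ?cab_ge0 // mulr_ge0 ?nrm_ge0.
Qed.

Lemma pythag x y : ip x y = 0 -> nrm (x + y) ^+ 2 = nrm x ^+ 2 + nrm y ^+ 2.
Proof.
by move=> h; rewrite !nrm2 ipDl !ipDr h (ipC y x) h rmorph0 addr0 add0r raddfD.
Qed.

Lemma parallelogram x y :
  nrm (x + y) ^+ 2 + nrm (x - y) ^+ 2 = 2 * nrm x ^+ 2 + 2 * nrm y ^+ 2.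
Proof.
rewrite !nrm2 !(ipDl, ipDr, ipNl, ipNr) !raddfD /= !raddfN /=; ring.
Qed.

(** * Sequences *)

Definition cvs (u : nat -> H) (l : H) :=
  forall e : R, 0 < e -> exists N, forall n, (N <= n)%N -> nrm (u n - l) < e.

Lemma cvs_unique (u : nat -> H) l l' : cvs u l -> cvs u l' -> l = l'.
Proof.
move=> h h'; apply/eqP; rewrite -subr_eq0; apply/eqP/nrm_eq0/eqP.
rewrite eq_le nrm_ge0 andbT leNgt; apply/negP => p.
have p2 : 0 < nrm (l - l') / 2 by rewrite divr_gt0.
have [N1 h1] := h _ p2; have [N2 h2] := h' _ p2.
have := nrmD (l - u (maxn N1 N2)) (u (maxn N1 N2) - l').
rewrite addrA subrK (nrmBC l (u _)).
have := h1 _ (leq_maxl N1 N2); have := h2 _ (leq_maxr N1 N2).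
lra.
Qed.

Lemma cvs_complete (u : nat -> H) :
  (forall e : R, 0 < e -> exists N, forall m n, (N <= m)%N -> (N <= n)%N ->
     nrm (u m - u n) < e) -> exists l, cvs u l.
Proof.
move=> hc.
have cu : cauchy (u @ \oo).
  apply/cauchy_ballP => e e0.
  have e0' : 0 < complex.Re e by move: e0; rewrite ltcE => /andP[].
  have [N hN] := hc _ e0'.
  have eE : (complex.Re e)%:C = e by rewrite RRe_real ?gtr0_real.
  exists (u @` [set k | (N <= k)%N], u @` [set k | (N <= k)%N]).
    by split; exists N => // k /= Nk; exists k.
  move=> [a b] /= [[m Nm <-] [n Nn <-]].
  by rewrite -ball_normE /= nrmE -eE ltcR; exact: hN.
have /cauchy_cvgP cu' := cu.
exists (lim (u @ \oo)) => e e0.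
have := @cvgr_dist_lt _ _ _ _ _ _ _ cu' e%:C.
rewrite ltcR => /(_ _ e0) [N _ hN]; exists N => n Nn.
by have := hN n Nn; rewrite /= nrmE ltcR nrmBC.
Qed.

Lemma cvs_ip (u : nat -> H) l y (c : R[i]) :
  cvs u l -> (forall n, ip (u n) y = c) -> ip l y = c.
Proof.
move=> ul h; apply/eqP; rewrite -subr_eq0; apply/eqP/cab_eq0/eqP.
rewrite eq_le cab_ge0 andbT leNgt; apply/negP => p.
have p2 : 0 < cab (ip l y - c) / (nrm y + 1) by rewrite divr_gt0// ltr_wpDl ?nrm_ge0.
have [N hN] := ul _ p2.
have := hN N (leqnn _); rewrite ltr_pdivlMr ?ltr_wpDl ?nrm_ge0// => h1.
have := CS (u N - l) y; rewrite ipBl h => h2.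
have h3 : cab (c - ip l y) = cab (ip l y - c) by rewrite /cab -normrN opprB.
have := nrm_ge0 (u N - l); rewrite h3 in h2; nra.
Qed.

End Hilbert.

(** * Bounded operators *)

Section Operators2.
Context {R : realType} {H : completeNormedModType R[i]}.
Variable ip : {dot H for Num.conj}.
Hypothesis hn : hilbert_norm ip.
Implicit Types (x y z u v w : H) (S T A B P : H -> H) (K : set H).

Definition rip x y : R := complex.Re (ip x y).

Lemma rip_nrm x : rip x x = nrm x ^+ 2.
Proof. by rewrite (nrm2 hn). Qed.
Lemma ripC x y : rip x y = rip y x.
Proof. by rewrite /rip (ipC _ x y); case: (ip y x). Qed.
Lemma ripDl x y z : rip (x + y) z = rip x z + rip y z.
Proof. by rewrite /rip ipDl raddfD. Qed.
Lemma ripNl x y : rip (- x) y = - rip x y.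
Proof. by rewrite /rip ipNl raddfN. Qed.
Lemma ripZl (r : R) x y : rip (r%:C *: x) y = r * rip x y.
Proof. by rewrite /rip ipZl; case: (ip x y) => a b /=; rewrite mul0r subr0. Qed.
Lemma rip_CS x y : `|rip x y| <= nrm x * nrm y.
Proof. exact: le_trans (le_cab _) (CS hn _ _). Qed.
Lemma rip_CS' x y : rip x y <= nrm x * nrm y.
Proof. exact: le_trans (ler_norm _) (rip_CS _ _). Qed.

Definition bop T : Prop :=
  linear T /\ exists c : R, 0 <= c /\ forall x, nrm (T x) <= c * nrm x.

Lemma lopD T (bT : bop T) x y : T (x + y) = T x + T y.
Proof. by case: bT => h _; have := h 1 x y; rewrite !scale1r. Qed.
Lemma lop0 T (bT : bop T) : T 0 = 0.
Proof. by apply: (addrI (T 0)); rewrite -(lopD bT) !addr0. Qed.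
Lemma lopZ T (bT : bop T) (c : R[i]) x : T (c *: x) = c *: T x.
Proof. by case: (bT) => l _; have := l c x 0; rewrite (lop0 bT) !addr0. Qed.
Lemma lopN T (bT : bop T) x : T (- x) = - T x.
Proof. by rewrite -scaleN1r (lopZ bT) scaleN1r. Qed.
Lemma lopB T (bT : bop T) x y : T (x - y) = T x - T y.
Proof. by rewrite (lopD bT) (lopN bT). Qed.

Lemma bopP T : bounded_op T <-> bop T.
Proof.
split=> -[lT]; last first.
  move=> [c [c0 hc]]; split => // x.
  have bT : bop T by split => //; exists c.
  apply/cvgrPdist_lt => e e0.
  have eE : (complex.Re e)%:C = e by rewrite RRe_real ?gtr0_real.
  have e0' : 0 < complex.Re e by rewrite -ltcR eE.
  have d0 : 0 < (complex.Re e / (c + 1))%:C.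
    by rewrite ltcR divr_gt0// ltr_wpDl.
  apply/nbhs_ballP; exists (complex.Re e / (c + 1))%:C => //= y.
  rewrite -ball_normE /= nrmE ltcR ltr_pdivlMr ?ltr_wpDl// => h.
  rewrite -(lopB bT) nrmE -eE ltcR; apply: le_lt_trans (hc _) _.
  by have := nrm_ge0 (x - y); nra.
move=> cT; split => //.
have T0 : T 0 = 0 by apply: (addrI (T 0)); have := lT 1 0 0; rewrite !scale1r !addr0 => <-.
have TZ a u : T (a *: u) = a *: T u by have := lT a u 0; rewrite T0 !addr0.
have := cT 0; rewrite /continuous_at T0 => /cvgrPdist_lt /(_ 1 ltr01).
move=> /nbhs_ballP [d /= d0 hd].
have dE : (complex.Re d)%:C = d by rewrite RRe_real ?gtr0_real.
have d0' : 0 < complex.Re d by rewrite -ltcR dE.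
exists (2 / complex.Re d); split; first by rewrite divr_ge0 ?ltW.
move=> x; have [->|x0] := eqVneq x 0; first by rewrite T0 !nrm0 mulr0.
have nx : 0 < nrm x.
  by rewrite lt_neqAle nrm_ge0 andbT eq_sym; apply: contra_neq x0 => /nrm_eq0.
set s := complex.Re d / (2 * nrm x).
have s0 : 0 < s by rewrite divr_gt0// mulr_gt0.
have sd : s * nrm x = complex.Re d / 2 by rewrite /s; field; rewrite gt_eqF.
have : ball 0 d (s%:C *: x).
  by rewrite -ball_normE /= sub0r normrN nrmE (nrmZr _ (ltW s0)) sd -[ltRHS]dE ltcR; lra.
move=> /hd /=; rewrite TZ sub0r normrN nrmE (_ : 1 = 1%:C)// ltcR (nrmZr _ (ltW s0)) => h.
rewrite -(ler_pM2l s0); apply: (le_trans (ltW h)).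
by rewrite /s le_eqVlt; apply/orP; left; apply/eqP; field; rewrite !gt_eqF.
Qed.

Lemma bop_linear T (bT : bop T) x y (c : R[i]) : T (c *: x + y) = c *: T x + T y.
Proof. by case: bT => h _; exact: h. Qed.
Lemma bop_id : bop idfun.
Proof. by split; [move=> a u v|exists 1; split => // x; rewrite mul1r]. Qed.
Lemma bop_comp S T : bop S -> bop T -> bop (S \o T).
Proof.
move=> [lS [c [c0 hc]]] [lT [d [d0 hd]]]; split.
  by move=> a u v; rewrite /= lT lS.
exists (c * d); split; first exact: mulr_ge0.
move=> x /=; apply: le_trans (hc _) _.
by rewrite -mulrA ler_wpM2l.
Qed.
Lemma bop_add S T : bop S -> bop T -> bop (fun x => S x + T x).
Proof.
move=> [lS [c [c0 hc]]] [lT [d [d0 hd]]]; split.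
  by move=> a u v; rewrite /= lT lS scalerDr addrACA.
exists (c + d); split; first exact: addr_ge0.
by move=> x; apply: le_trans (nrmD _ _) _; rewrite mulrDl lerD.
Qed.
Lemma bop_scale (a : R[i]) T : bop T -> bop (fun x => a *: T x).
Proof.
move=> [lT [d [d0 hd]]]; split.
  by move=> b u v; rewrite /= lT scalerDr !scalerA mulrC.
exists (cab a * d); split; first by rewrite mulr_ge0 ?cab_ge0.
by move=> x; rewrite nrmZ -mulrA ler_wpM2l ?cab_ge0.
Qed.
Lemma bop_opp T : bop T -> bop (fun x => - T x).
Proof.
move=> h; have := bop_scale (-1) h; congr bop.
by apply/funext => x; rewrite scaleN1r.
Qed.
Lemma bop_sub S T : bop S -> bop T -> bop (fun x => S x - T x).
Proof. by move=> hS hT; apply: bop_add => //; apply: bop_opp. Qed.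
Lemma bop_cvs T (u : nat -> H) l : bop T -> cvs u l -> cvs (fun n => T (u n)) (T l).
Proof.
move=> bT ul e e0; have [lT [c [c0 hc]]] := bT.
have [N hN] := ul (e / (c + 1)) (divr_gt0 e0 (ltr_wpDl c0 ltr01)).
exists N => n /hN; rewrite ltr_pdivlMr ?ltr_wpDl// => h.
rewrite -(lopB bT); apply: le_lt_trans (hc _) _.
by have := nrm_ge0 (u n - l); nra.
Qed.

(** * Orthogonal projections *)

Definition csub K : Prop :=
  [/\ K 0, forall (c : R[i]) x y, K x -> K y -> K (c *: x + y)
    & forall (u : nat -> H) l, (forall n, K (u n)) -> cvs u l -> K l].

Lemma csub_nearest K x : csub K ->
  exists2 y, K y & forall z, K z -> nrm (x - y) <= nrm (x - z).
Proof.
move=> [K0 Kl Kc].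
pose E := [set nrm (x - z) | z in K].
have E0 : E !=set0 by exists (nrm (x - 0)); exists 0.
have Elb : has_lbound E by exists 0 => _ [z _ <-]; exact: nrm_ge0.
have hE : has_inf E by [].
pose d := inf E.
have dle z : K z -> d <= nrm (x - z) by move=> Kz; apply: ge_inf => //; exists z.
have d0 : 0 <= d by apply: lb_le_inf => // _ [z _ <-]; exact: nrm_ge0.
have hu n : exists z, K z /\ nrm (x - z) < d + n.+1%:R^-1.
  have n0 : 0 < n.+1%:R^-1 :> R by rewrite invr_gt0.
  by have [_ [z Kz <-] hz] := inf_adherent n0 hE; exists z.
have [u hu'] := choice hu.
have Ku n : K (u n) by case: (hu' n).
(* The midpoint of two approximants lies in [K], hence at distance at least [d] from [x]; the
   parallelogram law then makes a minimizing sequence Cauchy. *)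
have mid m n : nrm (u m - u n) ^+ 2 <= 2 * nrm (x - u m) ^+ 2 + 2 * nrm (x - u n) ^+ 2 - 4 * d ^+ 2.
  have Km : K ((2^-1 : R)%:C *: (u m + u n)).
    have := Kl (2^-1 : R)%:C (u m + u n) 0; rewrite addr0; apply => //.
    by have := Kl 1 (u m) (u n); rewrite scale1r; apply.
  have := parallelogram hn (x - u m) (x - u n).
  have -> : x - u m - (x - u n) = u n - u m by rewrite opprB addrC addrA subrK.
  have -> : x - u m + (x - u n) = (2 : R)%:C *: (x - (2^-1 : R)%:C *: (u m + u n)).
    rewrite scalerBr scalerA -rmorphM /= mulfV// scale1r.
    by rewrite (_ : (2 : R)%:C = 2) ?rmorph_nat// scaler_nat mulr2n opprD addrACA.
  rewrite nrmZr// (nrmBC (u n)) exprMn => h.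
  have := dle _ Km => h2.
  have : d ^+ 2 <= nrm (x - (2^-1)%:C *: (u m + u n)) ^+ 2 by rewrite ler_sqr ?nnegrE ?nrm_ge0.
  by lra.
have [y uy] : exists y, cvs u y.
  apply: cvs_complete => e e0.
  have [N hN] : exists N, (4 * d + 2) * 2 * N.+1%:R^-1 < e ^+ 2.
    have p : 0 < e ^+ 2 / ((4 * d + 2) * 2) by rewrite divr_gt0 ?exprn_gt0//; lra.
    have [N hN] := ltr_add_invr p.
    by exists N; rewrite mulrC -ltr_pdivlMr ?add0r; [rewrite add0r in hN|lra].
  exists N => m n Nm Nn; rewrite -ltr_sqr ?nnegrE ?nrm_ge0 ?ltW//.
  apply: le_lt_trans (mid _ _) _; apply: le_lt_trans hN.
  have q k : (N <= k)%N -> nrm (x - u k) ^+ 2 <= d ^+ 2 + (2 * d + 1) * N.+1%:R^-1.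
    move=> Nk; have [_ /ltW h] := hu' k.
    have i1 : k.+1%:R^-1 <= N.+1%:R^-1 :> R by rewrite lef_pV2 ?posrE// ler_nat.
    have i2 : N.+1%:R^-1 <= 1 :> R by rewrite invf_le1// ler1n.
    have i3 : 0 <= N.+1%:R^-1 :> R by [].
    have ab : nrm (x - u k) <= d + N.+1%:R^-1 by rewrite (le_trans h)// lerD2l.
    have a0 := nrm_ge0 (x - u k).
    by move: ab a0 i2 i3; move: (nrm _) (N.+1%:R^-1) => a b; nra.
  have := q _ Nm; have := q _ Nn.
  move: (N.+1%:R^-1) (nrm (x - u m)) (nrm (x - u n)) => b a1 a2; nra.
exists y; first exact: Kc uy.
move=> z Kz; suff : nrm (x - y) <= d by move=> h; exact: le_trans h (dle _ Kz).
apply/ler_addgt0Pr => e e0.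
have e2 : 0 < e / 2 by lra.
have [N1 h1] := uy _ e2; have [N2 h2] := ltr_add_invr e2.
have [N NN1 NN2] : exists2 N, (N1 <= N)%N & (N2 <= N)%N.
  by exists (maxn N1 N2); rewrite ?leq_maxl ?leq_maxr.
have := nrmD (x - u N) (u N - y); rewrite addrA subrK.
have := h1 N NN1; have [_] := hu' N.
have : N.+1%:R^-1 <= N2.+1%:R^-1 :> R by rewrite lef_pV2 ?posrE// ler_nat ltnS.
rewrite add0r in h2; move: (N.+1%:R^-1) (N2.+1%:R^-1) h2 => b1 b2; lra.
Qed.

Lemma csub_decomp K x : csub K ->
  exists2 y, K y & forall z, K z -> ip (x - y) z = 0.
Proof.
move=> cK; have [y Ky hy] := csub_nearest x cK; exists y => // z Kz.
have [K0 Kl _] := cK.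
have [z0|z0] := eqVneq (nrm z) 0; first by rewrite (nrm_eq0 z0) ip0r.
have := hy ((ip (x - y) z / ip z z) *: z + y) (Kl _ _ _ Kz Ky).
rewrite opprD addrA addrAC -ler_sqr ?nnegrE ?nrm_ge0// (nrm_sub_proj hn _ z0) => h.
apply/cab_eq0/eqP; rewrite -sqrf_eq0 eq_le sqr_ge0 andbT.
have p : 0 < nrm z ^+ 2 by rewrite exprn_gt0// lt_neqAle eq_sym z0 nrm_ge0.
have : cab (ip (x - y) z) ^+ 2 / nrm z ^+ 2 <= 0 by lra.
by rewrite ler_pdivrMr// mul0r.
Qed.

Definition orth_proj K P : Prop :=
  [/\ bop P, forall x, K (P x) & forall x z, K z -> ip (x - P x) z = 0].

Lemma orth_proj_exists K : csub K -> exists P, orth_proj K P.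
Proof.
move=> cK; have [K0 Kl Kc] := cK.
have /choice[P hP] x : exists y, K y /\ forall z, K z -> ip (x - y) z = 0.
  by have [y Ky hy] := csub_decomp x cK; exists y.
have KP x : K (P x) by case: (hP x).
have oP x z : K z -> ip (x - P x) z = 0 by case: (hP x) => _; exact.
have Pu x y : K y -> (forall z, K z -> ip (x - y) z = 0) -> P x = y.
  move=> Ky h; apply/eqP; rewrite -subr_eq0; apply/eqP/(ip_eq0 hn).
  have Kd : K (P x - y).
    have -> : P x - y = -1 *: y + P x by rewrite scaleN1r addrC.
    exact: Kl.
  have E : P x - y = (x - y) - (x - P x).
    by apply/esym; rewrite opprB addrC addrA subrK.
  by rewrite {1}E ipBl h// oP// subrr.
exists P; split => //; split.
  move=> a u v; apply: Pu; first exact: Kl.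
  move=> z Kz; rewrite opprD addrACA -scalerBr ipDl ipZl !oP//.
  by rewrite mulr0 addr0.
exists 1; split => // x; rewrite mul1r.
have := pythag hn (oP x _ (KP x)); rewrite subrK => h.
rewrite -ler_sqr ?nnegrE ?nrm_ge0// h.
by have := sqr_ge0 (nrm (x - P x)); lra.
Qed.

Lemma orth_proj_id K P x : orth_proj K P -> K x -> P x = x.
Proof.
move=> [_ KP oP] Kx; apply/eqP; rewrite eq_sym -subr_eq0; apply/eqP/(ip_eq0 hn).
by rewrite ipBr !oP// subrr.
Qed.

Lemma orth_proj_sa K P : orth_proj K P -> adjoint_of ip P P.
Proof.
move=> [_ KP oP] x y.
rewrite -[in LHS](subrK (P y) y) -[in RHS](subrK (P x) x) ipDr ipDl.
by rewrite (oP x _ (KP y)) (ipC ip (P x)) (oP y _ (KP x)) rmorph0.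
Qed.

Lemma orth_proj_is_projection K P : orth_proj K P -> is_projection ip P.
Proof.
move=> h; have [bP KP _] := h; split; first exact/bopP.
- by apply/funext => x /=; exact: orth_proj_id h (KP x).
- exact: orth_proj_sa h.
Qed.

(** * Adjoints and resolvents *)

Lemma adj_unique T S S' : adjoint_of ip T S -> adjoint_of ip T S' -> S = S'.
Proof.
move=> h h'; apply/funext => y; apply/eqP; rewrite -subr_eq0; apply/eqP/(ip_eq0 hn).
by rewrite ipBr -!h -h' subrr.
Qed.

Lemma adj_sym T S : adjoint_of ip T S -> adjoint_of ip S T.
Proof. by move=> h x y; rewrite ipC -h -ipC. Qed.

Lemma riesz (f : H -> R[i]) (c : R) :
  (forall a x y, f (a *: x + y) = a * f x + f y) ->
  (forall x, cab (f x) <= c * nrm x) -> exists y, forall x, f x = ip x y.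
Proof.
move=> lf hf.
have f0 : f 0 = 0.
  by apply: (addrI (f 0)); have := lf 1 0 0; rewrite scale1r !mul1r !addr0 => <-.
have fB x y : f (x - y) = f x - f y.
  have -> : x - y = -1 *: y + x by rewrite scaleN1r addrC.
  by rewrite lf mulN1r addrC.
pose K := [set x | f x = 0].
have cK : csub K.
  split => //=.
  - by move=> a x y; rewrite /K /= => fx fy; rewrite lf fx fy mulr0 addr0.
  move=> u l; rewrite /K /= => hu ul; apply/cab_eq0/eqP; rewrite eq_le cab_ge0 andbT leNgt.
  apply/negP => p.
  have c1 : 0 < `|c| + 1 by rewrite ltr_wpDl.
  have [N hN] := ul _ (divr_gt0 p c1).
  have := hN N (leqnn _); rewrite ltr_pdivlMr// => h1.
  have := hf (u N - l); rewrite fB hu sub0r.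
  have -> : cab (- f l) = cab (f l) by rewrite /cab normrN.
  have := ler_norm c; have := nrm_ge0 (u N - l); nra.
have [P [bP KP oP]] := orth_proj_exists cK.
have [h|[x0 fx0]] : (forall x, f x = 0) \/ exists x, f x != 0.
  have [h|h] := pselect (exists x, f x != 0); [by right|left => x].
  by apply: contrapT => /eqP fx; apply: h; exists x.
  by exists 0 => x; rewrite h ip0r.
pose z := x0 - P x0.
have fz : f z != 0 by rewrite /z fB (KP x0 : f _ = 0) subr0.
have zz : ip z z != 0.
  by apply: contra_neq fz => /(ip_eq0 hn) ->; rewrite f0.
exists (Num.conj (f z / ip z z) *: z) => x.
rewrite ipZr conjCK.
have Kx : K (x - (f x / f z) *: z).
  rewrite /K /= fB; have -> : f ((f x / f z) *: z) = f x.
    by have := lf (f x / f z) z 0; rewrite addr0 f0 addr0 => ->; field.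
  by rewrite subrr.
have := oP x0 _ Kx; rewrite -/z => h.
have : ip (x - (f x / f z) *: z) z = 0 by rewrite ipC h rmorph0.
rewrite ipBl ipZl => /eqP; rewrite subr_eq0 => /eqP ->.
by field; rewrite fz zz.
Qed.

Lemma adj_exists T : bop T -> exists2 S, bop S & adjoint_of ip T S.
Proof.
move=> bT; have [lT [c [c0 hc]]] := bT.
have /choice[S hS] y : exists z, forall x, ip (T x) y = ip x z.
  apply: (@riesz _ (c * nrm y)).
    by move=> a u v; rewrite lT ipDl ipZl.
  move=> x; apply: le_trans (CS hn _ _) _.
  by rewrite mulrAC ler_wpM2r ?nrm_ge0.
have aS : adjoint_of ip T S by move=> x y; exact: hS.
exists S => //; split.
  move=> a u v; apply/eqP; rewrite -subr_eq0; apply/eqP/(ip_eq0 hn).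
  rewrite ipBr ipDr ipZr -!hS ipDr ipZr.
  by rewrite subrr.
exists c; split => // y.
have [->|p] := eqVneq (nrm (S y)) 0; first by rewrite mulr_ge0 ?nrm_ge0.
have p' : 0 < nrm (S y) by rewrite lt_neqAle eq_sym p nrm_ge0.
rewrite -(ler_pM2l p') -expr2 -rip_nrm /rip -hS.
apply: le_trans (ler_norm _) _; apply: le_trans (le_cab _) _.
apply: le_trans (CS hn _ _) _.
by have := hc (S y); have := nrm_ge0 y; nra.
Qed.

Definition positive A := adjoint_of ip A A /\ forall x, 0 <= rip (A x) x.

(** The resolvent (1 + A)^-1. For bounded positive [A] the default 0 is never reached, since 1 + A
    is onto. *)
Definition res A x : H := xget 0 [set y | y + A y = x].

Section Resolvent.
Variable A : H -> H.
Hypotheses (bA : bop A) (pA : positive A).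

Let B x := x + A x.
Let bB : bop B. Proof. exact: bop_add bop_id bA. Qed.

Let Bge x : nrm x ^+ 2 <= rip (B x) x.
Proof. by rewrite ripDl rip_nrm; have [_ /(_ x)] := pA; lra. Qed.

Let Bge' x : nrm x <= nrm (B x).
Proof.
have [->|p] := eqVneq (nrm x) 0; first exact: nrm_ge0.
have p' : 0 < nrm x by rewrite lt_neqAle eq_sym p nrm_ge0.
by rewrite -(ler_pM2r p') -expr2; apply: le_trans (Bge x) (rip_CS' _ _).
Qed.

Let Bsurj x : exists y, B y = x.
Proof.
(* [B] is bounded below, so its range is closed; the orthogonal complement of the range is the
   kernel of the self-adjoint [B], which is 0. *)
have cK : csub (range B).
  split; first by exists 0 => //; rewrite (lop0 bB).
    by move=> a _ _ [u _ <-] [v _ <-]; exists (a *: u + v) => //; rewrite (bop_linear bB).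
  move=> u l hu ul.
  have /choice[v hv] n : exists w, B w = u n.
    by have [w _ hw] := hu n; exists w.
  have [w vw] : exists w, cvs v w.
    apply: cvs_complete => e e0.
    have e2 : 0 < e / 2 by lra.
    have [N hN] := ul _ e2; exists N => m n /hN hm /hN hn'.
    apply: le_lt_trans (Bge' _) _; rewrite (lopB bB) !hv.
    have := nrmD (u m - l) (l - u n); rewrite addrA subrK (nrmBC l); lra.
  exists w => //; apply: cvs_unique (bop_cvs bB vw) _.
  by move=> e /ul [N hN]; exists N => n /hN; rewrite hv.
have [P [_ KP oP]] := orth_proj_exists cK.
have z0 : x - P x = 0.
  apply: (ip_eq0 hn); have h y : ip (x - P x) (B y) = 0 by apply: oP; exists y.
  have sB : adjoint_of ip B B by move=> u v; rewrite ipDl ipDr (pA.1 u v).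
  have : B (x - P x) = 0 by apply: (ip_eq0 hn); rewrite sB h.
  move=> h0; have := Bge (x - P x); rewrite h0 /rip ip0l /= => h1.
  by rewrite ip_nrm// (_ : _ ^+ 2 = 0)//; apply/eqP; rewrite eq_le h1 sqr_ge0.
have [y _ hy] := KP x; exists y; rewrite hy.
by apply/eqP; rewrite eq_sym -subr_eq0 z0.
Qed.

Lemma resP x : res A x + A (res A x) = x.
Proof. by have [y hy] := Bsurj x; rewrite /res; case: xgetP => // /(_ y). Qed.

Lemma res_unique x y : y + A y = x -> res A x = y.
Proof.
move=> h; apply/eqP; rewrite -subr_eq0; apply/eqP/nrm_eq0/eqP.
rewrite eq_le nrm_ge0 andbT; apply: le_trans (Bge' _) _.
by rewrite (lopB bB) /B resP h subrr nrm0.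
Qed.

Lemma resK x : res A (x + A x) = x.
Proof. exact: res_unique. Qed.

Lemma nrm_res x : nrm (res A x) <= nrm x.
Proof. by rewrite -[leRHS](congr1 nrm (resP x)); exact: Bge'. Qed.

Lemma bop_res : bop (res A).
Proof.
split; last by exists 1; split => // x; rewrite mul1r nrm_res.
move=> a u v; apply: res_unique; rewrite (bop_linear bA).
by rewrite addrACA -scalerDr !resP.
Qed.

Lemma res_sa : adjoint_of ip (res A) (res A).
Proof.
move=> x y; rewrite -{1}(resP y) -{2}(resP x) ipDr ipDl.
by rewrite (pA.1 (res A x)).
Qed.

(** This is X^2 <= X for the resolvent X, a consequence of 1 + A >= 1. It survives in the limit as
    half of the proof of idempotence. *)
Lemma rip_res_ge x : nrm (res A x) ^+ 2 <= rip (res A x) x.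
Proof. by rewrite [leRHS]ripC -{2}(resP x); exact: Bge. Qed.

Lemma res_comm T : bop T -> (forall x, T (A x) = A (T x)) ->
  forall x, T (res A x) = res A (T x).
Proof.
by move=> bT h x; apply/esym/res_unique; rewrite -h -(lopD bT) resP.
Qed.

End Resolvent.

End Operators2.

(** * Wandering subspaces *)

Section Wandering.
Context {R : realType} {H : completeNormedModType R[i]}.
Variable ip : {dot H for Num.conj}.
Hypothesis hn : hilbert_norm ip.
Implicit Types (x y z w : H) (L P : H -> H) (K G : set H).

Lemma vec_eq x y : (forall z, ip x z = ip y z) -> x = y.
Proof.
move=> h; apply/eqP; rewrite -subr_eq0; apply/eqP/(ip_eq0 hn).
by rewrite ipBl h subrr.
Qed.

(** Banach iteration for [y |-> v + L y]. The estimate is asked on [K] only: in [Xn_solve] it comes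
    from inner product formulas valid on [Vset]. *)
Lemma fixpoint K L (c : R) v : csub K -> bop L -> (forall x, K x -> K (L x)) ->
  0 <= c < 1 -> (forall x, K x -> nrm (L x) <= c * nrm x) -> K v ->
  exists2 y, K y & y = v + L y.
Proof.
move=> [K0 Kl Kc] bL KL /andP[c0 c1] hL Kv.
have KD x y : K x -> K y -> K (x + y).
  by move=> Kx Ky; have := Kl 1 x y Kx Ky; rewrite scale1r.
pose u := fix u n := if n is n'.+1 then v + L (u n') else 0.
have uS n : u n.+1 = v + L (u n) by [].
have Ku n : K (u n) by elim: n => // n IH; rewrite uS; apply: KD; [|exact: KL].
have KB x y : K x -> K y -> K (x - y).
  move=> Kx Ky; have -> : x - y = -1 *: y + x by rewrite scaleN1r addrC.
  exact: Kl.
have d1 k n : nrm (u (n + k)%N - u n) <= c ^+ n * nrm (u k).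
  elim: n => [|n IH]; first by rewrite expr0 mul1r subr0.
  rewrite addSn !uS opprD addrACA subrr add0r -(lopB bL) exprS -mulrA.
  by apply: le_trans (hL _ (KB _ _ (Ku _) (Ku _))) _; rewrite ler_wpM2l.
have ub k : nrm (u k) <= nrm v / (1 - c).
  elim: k => [|k IH].
    by rewrite nrm0 divr_ge0 ?nrm_ge0// subr_ge0 ltW.
  rewrite uS; apply: le_trans (nrmD _ _) _; have h := hL _ (Ku k).
  apply: le_trans (lerD (lexx _) h) _.
  have c2 : 1 - c != 0 by lra.
  have -> : nrm v / (1 - c) = nrm v + c * (nrm v / (1 - c)) by field.
  by rewrite lerD2l ler_wpM2l.
have [y uy] : exists y, cvs u y.
  apply: cvs_complete => e e0.
  have [N hN] : exists N, c ^+ N * (nrm v / (1 - c)) < e / 2.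
    have b0 : 0 <= nrm v / (1 - c) by rewrite divr_ge0 ?nrm_ge0// subr_ge0 ltW.
    have p : 0 < e / 2 / (nrm v / (1 - c) + 1) by rewrite !divr_gt0// ltr_wpDl.
    have cc : (fun n => c ^+ n) @ \oo --> (0 : R).
      by apply: cvg_expr; rewrite ger0_norm.
    have /cvgrPdist_lt /(_ _ p) [N _ hN] := cc.
    exists N; have := hN N (leqnn _).
    rewrite /= sub0r normrN ger0_norm ?exprn_ge0// ltr_pdivlMr ?ltr_wpDl//.
    have := exprn_ge0 N c0; move: (c ^+ N) (nrm v / (1 - c)) b0 => a b; nra.
  have q n : (N <= n)%N -> nrm (u n - u N) < e / 2.
    move=> /subnKC <-; apply: le_lt_trans (d1 _ _) _; apply: le_lt_trans hN.
    by rewrite ler_wpM2l ?exprn_ge0.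
  exists N => m n /q hm /q hn'.
  have := nrmD (u m - u N) (u N - u n); rewrite addrA subrK (nrmBC (u N)); lra.
exists y; first exact: Kc uy.
apply: (@cvs_unique _ _ (fun n => u n.+1)).
  by move=> e /uy [N hN]; exists N => n Nn; apply: hN; exact: leqW.
move=> e /(bop_cvs bL uy) [N hN]; exists N => n /hN.
by rewrite uS opprD addrACA subrr add0r.
Qed.

(* The bi-orthogonal plays the role of the closed linear span: inclusions and
   orthogonality relations between generating sets extend to it for free. *)
Definition biorth G : set H :=
  [set w | forall z, (forall s, G s -> ip s z = 0) -> ip w z = 0].

Lemma biorth_sub G s : G s -> biorth G s.
Proof. by move=> Gs z; exact. Qed.

Lemma biorth_csub G : csub (biorth G).
Proof.
split.
- by move=> z _; rewrite ip0l.
- by move=> c x y hx hy z hz; rewrite ipDl ipZl hx// hy// mulr0 addr0.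
- by move=> u l hu ul z hz; apply: (cvs_ip hn ul) => n; exact: hu.
Qed.

(** The adjoint [L'] moves the test vector across, which takes the place of a density argument. *)
Lemma biorth_map G G' L L' : adjoint_of ip L L' ->
  (forall s, G s -> biorth G' (L s)) -> forall w, biorth G w -> biorth G' (L w).
Proof.
move=> aL h w Gw z hz; rewrite aL; apply: Gw => s Gs.
by rewrite -aL; apply: h.
Qed.

Lemma biorth_orth G G' : (forall s s', G s -> G' s' -> ip s s' = 0) ->
  forall w w', biorth G w -> biorth G' w' -> ip w w' = 0.
Proof.
move=> h w w' Gw Gw'; apply: Gw => s Gs; rewrite ipC.
by rewrite Gw' ?rmorph0// => s' Gs'; rewrite ipC h ?rmorph0.
Qed.

Lemma csub_lin K x y (a b : R[i]) : csub K -> K x -> K y -> K (a *: x + b *: y).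
Proof.
move=> [K0 Kl _] Kx Ky; apply: (Kl) => //.
by have := Kl b y 0 Ky K0; rewrite addr0.
Qed.
Lemma csubD K x y : csub K -> K x -> K y -> K (x + y).
Proof. by move=> cK Kx Ky; have := csub_lin 1 1 cK Kx Ky; rewrite !scale1r. Qed.
Lemma csubB K x y : csub K -> K x -> K y -> K (x - y).
Proof. by move=> cK Kx Ky; have := csub_lin 1 (-1) cK Kx Ky; rewrite scale1r scaleN1r. Qed.
Lemma csubZ K x (a : R[i]) : csub K -> K x -> K (a *: x).
Proof.
by move=> cK Kx; have := csub_lin a 0 cK Kx Kx; rewrite scale0r addr0.
Qed.
Variable S : set H.
Variable X : H -> H.
Hypothesis (aX : adjoint_of ip X X).
Local Notation W := (biorth S).

(** * One-sided geometric series along a wandering subspace *)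

Section Half.
Variables V V' : H -> H.
Hypotheses (bV : bop V) (bV' : bop V') (aV : adjoint_of ip V V').
Hypotheses (VK : cancel V V').
Hypothesis hS : forall k s s', S s -> S s' -> ip (iter k.+1 V s) s' = 0.
Hypothesis hX : forall k s, S s -> S (X (iter k.+1 V s)).

Definition halfset a : set H :=
  [set z | exists k s, S s /\ z = iter (k.*2 + a) V s].

Lemma ip_isom x y : ip (V x) (V y) = ip x y.
Proof. by rewrite aV VK. Qed.

Lemma ip_iter i j x y : ip (iter (i + j) V x) (iter j V y) = ip (iter i V x) y.
Proof. by elim: j => [|j IH]; [rewrite addn0|rewrite addnS ip_isom]. Qed.

Lemma ip_iter_neq i j s s' : S s -> S s' -> i != j ->
  ip (iter i V s) (iter j V s') = 0.
Proof.
wlog ij : i j s s' / (j < i)%N.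
  move=> h Ss Ss' ij; have [lt|le] := ltnP j i; first exact: h.
  by rewrite ipC h ?rmorph0// 1?eq_sym// ltn_neqAle ij.
by move=> Ss Ss' _; rewrite -(subnK (ltnW ij)) ip_iter -(prednK (_ : 0 < i - j)%N) ?subn_gt0// hS.
Qed.

Lemma half_V a y : biorth (halfset a) y -> biorth (halfset a.+1) (V y).
Proof.
apply: (biorth_map aV) => _ [k [s [Ss ->]]]; apply: biorth_sub.
by exists k, s; rewrite addnS.
Qed.

Lemma half_shift a y : biorth (halfset a.+2) y -> biorth (halfset a) y.
Proof.
apply: (@biorth_map _ _ idfun idfun) => // _ [k [s [Ss ->]]]; apply: biorth_sub.
by exists k.+1, s; rewrite doubleS !addnS !addSn.
Qed.

Lemma half_X a y : biorth (halfset a.+1) y -> W (X y).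
Proof.
apply: (biorth_map aX) => _ [k [s [Ss ->]]]; apply: biorth_sub.
by rewrite addnS; exact: hX.
Qed.

Lemma half_orthW a y w : biorth (halfset a.+1) y -> W w -> ip y w = 0.
Proof.
apply: biorth_orth => _ s [k [s' [Ss' ->]]] Ss.
by rewrite addnS; exact: hS.
Qed.

Lemma half_odd a b y y' : odd (a + b) -> biorth (halfset a) y ->
  biorth (halfset b) y' -> ip y y' = 0.
Proof.
move=> ab; apply: biorth_orth => _ _ [k [s [Ss ->]]] [l [s' [Ss' ->]]].
apply: ip_iter_neq => //; apply: contraTneq ab => /(congr1 odd).
by rewrite !oddD !odd_double /= => ->; rewrite addbb.
Qed.

Lemma biorth_half w : W w -> biorth (halfset 0) w.
Proof.
apply: (@biorth_map _ _ idfun idfun) => // s Ss; apply: biorth_sub.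
by exists 0%N, s.
Qed.

Variable rho : R.
Hypothesis hrho : 0 <= rho < 1.

(** [y] is the series \sum_k rho^k V^(2 k) w, of which only the functional equation is used
    afterwards. *)
Lemma half_exists w : W w -> exists2 y, biorth (halfset 0) y & y = w + rho%:C *: V (V y).
Proof.
move=> Ww; apply: (@fixpoint _ (fun y => rho%:C *: V (V y)) rho) => //.
- exact: biorth_csub.
- by apply: bop_scale; exact: (bop_comp bV bV).
- move=> x hx; have h := half_shift (half_V (half_V hx)).
  by apply: csubZ h; exact: biorth_csub.
- move=> x _; have [r0 _] := andP hrho; rewrite nrmZr//.
  suff -> : nrm (V (V x)) = nrm x by [].
  apply/eqP; rewrite -(eqrXn2 (_ : 0 < 2)%N) ?nrm_ge0//.
  by rewrite !(nrm2 hn) !ip_isom.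
- exact: biorth_half.
Qed.

(** Expanding both functional equations, the cross terms vanish since V^2 y is orthogonal to [W],
    and [V] is isometric; the factor 1 - rho^2 sums the geometric series. *)
Lemma half_ip w w' y y' : W w -> W w' -> biorth (halfset 0) y -> biorth (halfset 0) y' ->
  y = w + rho%:C *: V (V y) -> y' = w' + rho%:C *: V (V y') ->
  (1 - rho%:C ^+ 2) * ip y y' = ip w w'.
Proof.
move=> Ww Ww' hy hy' e e'.
have : ip y y' = ip w w' + rho%:C ^+ 2 * ip y y'.
  rewrite {1}e {1}e' ipDl !ipDr !ipZl !ipZr !ip_isom conj_rc.
  rewrite (half_orthW (half_V (half_V hy))) // (ipC ip w (V _)).
  rewrite (half_orthW (half_V (half_V hy'))) // rmorph0.
  by ring.
by move=> E; rewrite mulrBl mul1r {1}E; ring.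
Qed.

End Half.
End Wandering.

(** * The resolvents of the powers of [X (V - V^-1)] *)

Section Martingale.
Context {R : realType} {H : completeNormedModType R[i]}.
Variable ip : {dot H for Num.conj}.
Hypothesis hn : hilbert_norm ip.
Implicit Types (x y z w : H) (L P : H -> H) (K : set H).

Lemma ipZr_rc (r : R) x y : ip x (r%:C *: y) = r%:C * ip x y.
Proof. by rewrite ipZr conj_rc. Qed.

Lemma rip_adj L L' x y : adjoint_of ip L L' -> rip ip (L x) y = rip ip x (L' y).
Proof. by move=> h; rewrite /rip h. Qed.

Lemma adj_scale L L' (r : R) : adjoint_of ip L L' ->
  adjoint_of ip (fun x => r%:C *: L x) (fun x => r%:C *: L' x).
Proof. by move=> h x y; rewrite ipZl ipZr_rc h. Qed.

Lemma positive_conj L L' P : adjoint_of ip L L' -> positive ip P ->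
  positive ip (fun x => L' (P (L x))).
Proof.
move=> aL [sP pP]; split; first by move=> x y; rewrite (adj_sym aL) sP aL.
by move=> x; rewrite (rip_adj _ _ (adj_sym aL)).
Qed.

Lemma positive_id : positive ip idfun.
Proof. by split=> // x; rewrite (rip_nrm hn) sqr_ge0. Qed.

Lemma positive_scale P (r : R) : 0 <= r -> positive ip P ->
  positive ip (fun x => r%:C *: P x).
Proof.
move=> r0 [sP pP]; split; first exact: adj_scale.
by move=> x; rewrite ripZl mulr_ge0.
Qed.

Variable S : set H.
Variables X V V' : H -> H.
Hypotheses (bX : bop X) (aX : adjoint_of ip X X) (XK : involutive X).
Hypotheses (bV : bop V) (bV' : bop V') (aV : adjoint_of ip V V').
Hypotheses (VK : cancel V V') (V'K : cancel V' V).
Hypothesis hS : forall k s s', S s -> S s' -> ip (iter k.+1 V s) s' = 0.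
Hypothesis hX : forall k s, S s -> S (X (iter k.+1 V s)).
Hypothesis hX' : forall k s, S s -> S (X (iter k.+1 V' s)).
Local Notation W := (biorth ip S).

Variable e : H.
Hypothesis he : forall k s, S s -> ip (iter k.+1 V s) e = 0.
Hypothesis he' : forall k s, S s -> ip (iter k.+1 V' s) e = 0.

Variable t : R.
Hypothesis ht : 0 < t < 1.

Let t0 : 0 < t. Proof. by case/andP: ht. Qed.
Let t1 : t < 1. Proof. by case/andP: ht. Qed.
Let tn0 : t%:C != 0 :> R[i].
Proof. by rewrite (_ : 0 = 0%:C)// (inj_eq (@complexI _)) gt_eqF. Qed.
Let t1n0 : 1 - t%:C != 0 :> R[i].
Proof.
rewrite (_ : 1 = 1%:C)// -rmorphB (_ : 0 = 0%:C)// (inj_eq (@complexI _)) gt_eqF//.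
by rewrite subr_gt0.
Qed.
Let t2n0 : 1 + t%:C != 0 :> R[i].
Proof.
rewrite (_ : 1 = 1%:C)// -rmorphD (_ : 0 = 0%:C)// (inj_eq (@complexI _)) gt_eqF//.
by rewrite addr_gt0.
Qed.

Let aV' : adjoint_of ip V' V. Proof. exact: adj_sym. Qed.

Lemma adj_iter k : adjoint_of ip (iter k V) (iter k V').
Proof. by elim: k => // k IH x y; rewrite iterS iterSr aV IH. Qed.

Lemma hSinv k s s' : S s -> S s' -> ip (iter k.+1 V' s) s' = 0.
Proof.
by move=> Ss Ss'; rewrite (adj_sym (adj_iter k.+1)) ipC hS ?rmorph0.
Qed.

Local Notation Gp := (halfset S V).
Local Notation Gm := (halfset S V').

(** A negative power on the right becomes a positive power on the left, so the total power of [V]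
    stays positive. *)
Lemma half_cross a b y y' : biorth ip (Gp a.+1) y -> biorth ip (Gm b) y' -> ip y y' = 0.
Proof.
apply: (biorth_orth) => _ _ [k [s [Ss ->]]] [l [s' [Ss' ->]]].
by rewrite -adj_iter -iterD !addnS hS.
Qed.

(* The element of trace 1 proportional to (1 + wt 1 * (V - V^-1)^* (V - V^-1))^-1
   is the Poisson kernel \sum_k rho^|k| V^(2 k). *)
Definition rho : R := (1 - t) / (1 + t).
(** Equal to [t * wt 1] and also to [(1 - t) * wt n.+1 / wt n]; [Xn_step] rests on the coincidence
    of the two. *)
Definition gam : R := (1 - t ^+ 2) / (4 * t).
Definition wt n : R := (1 - t) / t * ((1 + t) / (4 * t)) ^+ n.

Lemma rho01 : 0 <= rho < 1.
Proof.
move: t0 t1 => h0 h1; rewrite /rho; apply/andP; split; first by apply: divr_ge0; lra.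
by rewrite ltr_pdivrMr; lra.
Qed.
Lemma wt_gt0 n : 0 < wt n.
Proof.
by rewrite /wt mulr_gt0 ?exprn_gt0// divr_gt0// ?mulr_gt0// ?subr_gt0// addr_gt0.
Qed.
Let natC n : (n%:R : R)%:C = n%:R :> R[i]. Proof. exact: rmorph_nat. Qed.
Lemma rhoE : rho%:C = (1 - t%:C) / (1 + t%:C) :> R[i].
Proof. by rewrite /rho fmorph_div rmorphB rmorphD rmorph1. Qed.
Lemma gamE : gam%:C = (1 - t%:C ^+ 2) / (4 * t%:C) :> R[i].
Proof. by rewrite /gam fmorph_div rmorphB rmorph1 rmorphXn rmorphM /= natC. Qed.
Lemma wt0E : (wt 0)%:C = (1 - t%:C) / t%:C :> R[i].
Proof. by rewrite /wt expr0 mulr1 fmorph_div rmorphB rmorph1. Qed.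
Lemma wtSE n : (wt n.+1)%:C = (1 + t%:C) / (4 * t%:C) * (wt n)%:C :> R[i].
Proof.
have -> : wt n.+1 = (1 + t) / (4 * t) * wt n by rewrite /wt exprS mulrCA.
rewrite (rmorphM (real_complex R) ((1 + t) / (4 * t))) fmorph_div rmorphD rmorph1.
by rewrite (rmorphM (real_complex R) 4) /= natC.
Qed.

(* [iterT n] is T^*n T^n for T = X (V - V^-1); [dop'] is the adjoint of [dop]. *)
Definition dop x := V x - V' x.
Definition dop' x := V' x - V x.
Lemma bop_dop : bop dop. Proof. exact: bop_sub. Qed.
Lemma bop_dop' : bop dop'. Proof. exact: bop_sub. Qed.
Lemma adj_dop : adjoint_of ip dop dop'.
Proof. by move=> x y; rewrite ipBl ipBr aV aV'. Qed.

Fixpoint iterT n x := if n is n'.+1 then dop' (X (iterT n' (X (dop x)))) else x.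

Lemma bop_iterT n : bop (iterT n).
Proof.
elim: n => [|n IH]; first exact: bop_id.
exact: (bop_comp bop_dop' (bop_comp bX (bop_comp IH (bop_comp bX bop_dop)))).
Qed.

Lemma positive_iterT n : positive ip (iterT n).
Proof.
elim: n => [|n IH]; first exact: positive_id.
have := positive_conj adj_dop (positive_conj aX IH).
by [].
Qed.

Definition Xn n := res (fun x => (wt n)%:C *: iterT n x).

Let bA n : bop (fun x => (wt n)%:C *: iterT n x).
Proof. exact: (bop_scale _ (bop_iterT n)). Qed.
Let pA n : positive ip (fun x => (wt n)%:C *: iterT n x).
Proof. by apply: positive_scale; [exact: ltW (wt_gt0 _)|exact: positive_iterT]. Qed.

Lemma bop_Xn n : bop (Xn n).
Proof. exact: (bop_res hn (bA n) (pA n)). Qed.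
Lemma XnP n x : Xn n x + (wt n)%:C *: iterT n (Xn n x) = x.
Proof. exact: (resP hn (bA n) (pA n)). Qed.
Lemma Xn_unique n x y : y + (wt n)%:C *: iterT n y = x -> Xn n x = y.
Proof. exact: (res_unique hn (bA n) (pA n)). Qed.

(* [aop w] is \sum_k rho^|k| V^(2 k) w for [w] in [W], see [aopW]. *)
Definition aop x := (t^-1)%:C *: Xn 1 x.
Lemma bop_aop : bop aop. Proof. exact: (bop_scale _ (bop_Xn 1)). Qed.

Lemma iterT1 x : iterT 1 x = 2 *: x - V (V x) - V' (V' x).
Proof.
rewrite /= XK /dop /dop' (lopB bV) (lopB bV') V'K VK.
by apply: (vec_eq hn) => z; rewrite !(ipDl, ipNl, ipZl); ring.
Qed.

Lemma aop_unique x y : t%:C *: y + (wt 1)%:C *: iterT 1 (t%:C *: y) = x -> aop x = y.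
Proof.
move=> h; rewrite /aop (Xn_unique h) scalerA -rmorphM mulVf ?gt_eqF//.
by rewrite rmorph1 scale1r.
Qed.

(** [p] sums the powers V^(2 k) with k >= 0 and [m] those with k <= 0, so [w] is counted twice. The
    two functional equations suffice to check that the sum inverts the operator defining [aop]. *)
Lemma aopW w : W w -> exists p m, [/\ biorth ip (Gp 0) p, biorth ip (Gm 0) m,
  p = w + rho%:C *: V (V p), m = w + rho%:C *: V' (V' m) & aop w = p + m - w].
Proof.
move=> Ww.
have [p hp pE] := half_exists hn bV aV VK rho01 Ww.
have [m hm mE] := half_exists hn bV' aV' V'K rho01 Ww.
exists p, m; split => //; apply: aop_unique.
have V'Vp : V' (V' p) = V' (V' w) + rho%:C *: p.
  by rewrite {1}pE !(lopD bV', lopZ bV') !VK.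
have VVm : V (V m) = V (V w) + rho%:C *: m.
  by rewrite {1}mE !(lopD bV, lopZ bV) !V'K.
rewrite (lopZ (bop_iterT 1)) iterT1 !(lopD bV, lopN bV, lopD bV', lopN bV') V'Vp VVm.
rewrite wtSE wt0E.
apply: (vec_eq hn) => z; rewrite !(ipDl, ipNl, ipZl).
have pz : ip p z = ip w z + rho%:C * ip (V (V p)) z by rewrite {1}pE ipDl ipZl.
have mz : ip m z = ip w z + rho%:C * ip (V' (V' m)) z by rewrite {1}mE ipDl ipZl.
rewrite pz mz rhoE.
by field; rewrite tn0 t2n0.
Qed.

(** * Even and odd parts derived from the Poisson kernel *)

Definition alop x := aop x - x.
Definition phop x := aop (dop x).
Lemma bop_alop : bop alop. Proof. exact: (bop_sub bop_aop bop_id). Qed.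
Lemma aop_dop x : aop (dop x) = dop (aop x).
Proof.
rewrite /aop (lopZ bop_dop); congr (_ *: _); apply/esym.
apply: (res_comm hn (bA 1) (pA 1) bop_dop) => y.
rewrite (lopZ bop_dop); congr (_ *: _); rewrite !iterT1.
by rewrite !(lopB bop_dop) (lopZ bop_dop) /dop !(lopB bV, lopB bV') !VK !V'K.
Qed.

(** On [W], [alop] is the kernel without its constant term and has only even nonzero powers of [V];
    [phop] has only odd ones. Hence their orthogonality to [W] and to each other. *)
Lemma phop_alop w : W w -> exists p m, [/\ biorth ip (Gp 0) p, biorth ip (Gm 0) m,
  p = w + rho%:C *: V (V p), m = w + rho%:C *: V' (V' m)
  & alop w = rho%:C *: (V (V p) + V' (V' m))
  /\ phop w = (1 - rho)%:C *: (V p - V' m)].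
Proof.
move=> Ww; have [p [m [hp hm pE mE aE]]] := aopW Ww.
exists p, m; split=> //; split.
  by rewrite /alop aE {1}pE {1}mE; apply: (vec_eq hn) => z;
     rewrite !(ipDl, ipNl, ipZl); ring.
rewrite /phop aop_dop aE /dop.
have V'p : V' p = V' w + rho%:C *: V p by rewrite {1}pE (lopD bV') (lopZ bV') VK.
have Vm : V m = V w + rho%:C *: V' m by rewrite {1}mE (lopD bV) (lopZ bV) V'K.
rewrite !(lopB bV, lopB bV', lopD bV, lopD bV') V'p Vm rmorphB rmorph1.
by apply: (vec_eq hn) => z; rewrite !(ipDl, ipNl, ipZl); ring.
Qed.

(* Contains the subspaces V^k W, k <> 0, which [X] maps back into [W]; the
   vector [e] is an auxiliary one they are all orthogonal to. *)
Definition Vset : set H :=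
  [set v | [/\ W (X v), forall w, W w -> ip v w = 0 & ip v e = 0]].

Lemma Vset_csub : csub Vset.
Proof.
have cW := biorth_csub hn S; have [W0 Wl Wc] := cW.
split.
- by split=> [|w _|]; rewrite ?(lop0 bX)// ip0l.
- move=> c x y [hx ox ex] [hy oy ey]; split=> [|w Ww|].
  + by rewrite (bop_linear bX); exact: Wl.
  + by rewrite ipDl ipZl ox// oy// mulr0 addr0.
  + by rewrite ipDl ipZl ex ey mulr0 addr0.
- move=> u l hu ul; split=> [|w Ww|].
  + apply: (Wc (fun n => X (u n))) => [n|]; first by case: (hu n).
    exact: bop_cvs.
  + by apply: (cvs_ip hn ul) => n; case: (hu n) => _ h _; exact: h.
  + by apply: (cvs_ip hn ul) => n; case: (hu n).
Qed.

Lemma half_Vset a y : biorth ip (Gp a.+1) y -> Vset y.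
Proof.
move=> hy; split=> [|w|]; [exact: (half_X aX hX hy)|exact: (half_orthW hS hy)|].
by apply: hy => _ [k [s [Ss ->]]]; rewrite addnS he.
Qed.
Lemma half_Vset' a y : biorth ip (Gm a.+1) y -> Vset y.
Proof.
move=> hy; split=> [|w|]; [exact: (half_X aX hX' hy)|exact: (half_orthW hSinv hy)|].
by apply: hy => _ [k [s [Ss ->]]]; rewrite addnS he'.
Qed.

Lemma alop_Vset w : W w -> Vset (alop w).
Proof.
move=> /phop_alop [p [m [hp hm _ _ [-> _]]]]; apply: (csubZ _ Vset_csub).
apply: (csubD Vset_csub); first exact: (half_Vset (half_V aV (half_V aV hp))).
exact: (half_Vset' (half_V aV' (half_V aV' hm))).
Qed.

Lemma phop_Vset w : W w -> Vset (phop w).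
Proof.
move=> /phop_alop [p [m [hp hm _ _ [_ ->]]]]; apply: (csubZ _ Vset_csub).
apply: (csubB Vset_csub); first exact: (half_Vset (half_V aV hp)).
exact: (half_Vset' (half_V aV' hm)).
Qed.

Let rho2 : 1 - rho%:C ^+ 2 = 4 * t%:C / (1 + t%:C) ^+ 2 :> R[i].
Proof. by rewrite rhoE; field. Qed.

Let half_ipE w w' p p' : (1 - rho%:C ^+ 2) * ip p p' = ip w w' ->
  ip p p' = (1 + t%:C) ^+ 2 / (4 * t%:C) * ip w w'.
Proof. by rewrite rho2 => <-; field; rewrite tn0 t2n0. Qed.

(** The constant is 2 rho^2 / (1 - rho^2): positive and negative powers contribute equally. *)
Lemma alop_ip w w' : W w -> W w' ->
  ip (alop w) (alop w') = (1 - t%:C) ^+ 2 / (2 * t%:C) * ip w w'.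
Proof.
move=> Ww Ww'; have [p [m [hp hm pE mE [-> _]]]] := phop_alop Ww.
have [p' [m' [hp' hm' pE' mE' [-> _]]]] := phop_alop Ww'.
rewrite ipZl ipZr_rc !(ipDl, ipDr) !(ip_isom aV VK) !(ip_isom aV' V'K).
rewrite (half_cross (half_V aV (half_V aV hp)) (half_V aV' (half_V aV' hm'))).
rewrite (ipC ip (V' _)) (half_cross (half_V aV (half_V aV hp')) (half_V aV' (half_V aV' hm))).
rewrite (half_ipE (half_ip aV VK hS Ww Ww' hp hp' pE pE')).
rewrite (half_ipE (half_ip aV' V'K hSinv Ww Ww' hm hm' mE mE')).
by rewrite rmorph0 rhoE; field; rewrite tn0 t2n0.
Qed.

(** The constant is 2 (1 - rho)^2 / (1 - rho^2), and (1 - rho) / (1 + rho) = t. *)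
Lemma phop_ip w w' : W w -> W w' -> ip (phop w) (phop w') = 2 * t%:C * ip w w'.
Proof.
move=> Ww Ww'; have [p [m [hp hm pE mE [_ ->]]]] := phop_alop Ww.
have [p' [m' [hp' hm' pE' mE' [_ ->]]]] := phop_alop Ww'.
rewrite ipZl ipZr_rc !(ipBl, ipBr) !(ip_isom aV VK) !(ip_isom aV' V'K).
rewrite (half_cross (half_V aV hp) (half_V aV' hm')).
rewrite (ipC ip (V' _)) (half_cross (half_V aV hp') (half_V aV' hm)).
rewrite (half_ipE (half_ip aV VK hS Ww Ww' hp hp' pE pE')).
rewrite (half_ipE (half_ip aV' V'K hSinv Ww Ww' hm hm' mE mE')).
by rewrite rmorph0 rmorphB rmorph1 /= rhoE; field; rewrite tn0 t2n0.
Qed.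

Lemma phop_alop_ip w w' : W w -> W w' -> ip (phop w) (alop w') = 0.
Proof.
move=> Ww Ww'; have [p [m [hp hm _ _ [_ ->]]]] := phop_alop Ww.
have [p' [m' [hp' hm' _ _ [-> _]]]] := phop_alop Ww'.
rewrite ipZl ipZr_rc !(ipBl, ipDr).
rewrite (half_cross (half_V aV hp) (half_V aV' (half_V aV' hm'))).
rewrite (ipC ip (V' _)) (half_cross (half_V aV (half_V aV hp')) (half_V aV' hm)).
rewrite (half_odd aV VK hS _ (half_V aV hp) (half_V aV (half_V aV hp')))//.
rewrite (half_odd aV' V'K hSinv _ (half_V aV' hm) (half_V aV' (half_V aV' hm')))//.
by rewrite rmorph0; ring.
Qed.

(** * Recursion for the resolvents and their covariances *)

Definition centred n := forall w, W w -> Vset (Xn n w - t%:C *: w).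
(** [c] is the covariance of X_n and X_m, both of which have mean [t] on [W]. *)
Definition prods n m (c : R) := forall w w', W w -> W w' ->
  ip (Xn n w) (Xn m w') = (t%:C ^+ 2 + c%:C) * ip w w'.

Lemma centred_ip n w w' : centred n -> W w -> W w' -> ip (Xn n w) w' = t%:C * ip w w'.
Proof.
move=> cn Ww Ww'; have [_ /(_ _ Ww') + _] := cn _ Ww.
by rewrite ipBl ipZl => /eqP; rewrite subr_eq0 => /eqP.
Qed.

(* With R = X X_n X, which is centred at t, [beta n] is (t - R) / (1 - t). *)
Definition beta n y := (- (1 - t)^-1)%:C *: (X (Xn n (X y)) - t%:C *: y).

Lemma bop_beta n : bop (beta n).
Proof.
apply: bop_scale; apply: bop_sub; last exact: (bop_scale _ bop_id).
exact: (bop_comp bX (bop_comp (bop_Xn n) bX)).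
Qed.

(** One syllable of an alternating word: [X] takes [Vset] into [W], X_n - t takes [W] into [Vset],
    and [X] leads back to [W]. *)
Lemma beta_W n y : centred n -> Vset y -> W (beta n y).
Proof.
move=> cn [Wy _ _]; have [h _ _] := cn _ Wy.
apply: (csubZ _ (biorth_csub hn S)).
by move: h; rewrite (lopB bX) (lopZ bX) XK.
Qed.

Lemma beta_ip n m c y y' : centred n -> centred m -> prods n m c ->
  Vset y -> Vset y' ->
  ip (beta n y) (beta m y') = c%:C / (1 - t%:C) ^+ 2 * ip y y'.
Proof.
move=> cn cm hc [Wy _ _] [Wy' _ _].
have E k u : X (Xn k (X u)) - t%:C *: u = X (Xn k (X u) - t%:C *: X u).
  by rewrite (lopB bX) (lopZ bX) XK.
rewrite /beta !E ipZl ipZr_rc aX XK.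
have -> : ip y y' = ip (X y) (X y') by rewrite aX XK.
rewrite ipBl !ipBr !ipZl !ipZr_rc hc// (centred_ip cn)//.
rewrite (ipC ip _ (Xn m _)) (centred_ip cm)// rmorphM /= conj_rc -ipC.
by rewrite rmorphN fmorphV rmorphB rmorph1; field.
Qed.

Let wt1E : (wt 1)%:C = (1 - t%:C ^+ 2) / (4 * t%:C ^+ 2) :> R[i].
Proof. by rewrite wtSE wt0E; field. Qed.

Let t3n0 : 1 - t%:C ^+ 2 != 0 :> R[i].
Proof.
have -> : 1 - t%:C ^+ 2 = (1 - t%:C) * (1 + t%:C) :> R[i] by ring.
by rewrite mulf_neq0.
Qed.

Lemma iterT_aop u : gam%:C *: iterT 1 (aop u) = u - t%:C *: aop u.
Proof.
rewrite /aop (lopZ (bop_iterT 1)) -{2}(XnP 1 u).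
apply: (vec_eq hn) => z; rewrite !(ipDl, ipNl, ipZl).
by rewrite fmorphV gamE wt1E; field; rewrite ?tn0 ?t3n0.
Qed.

Lemma dop'_dop u : dop' u = - dop u.
Proof. by rewrite /dop /dop' opprB. Qed.

Lemma iterT1_dop u : iterT 1 u = dop' (dop u).
Proof. by rewrite /= XK. Qed.

(* The equation for [y] sums the geometric series in [alop \o beta n], i.e. the
   alternating words in the centred elements [alop] and [beta n]. *)
Lemma Xn_step n w y : W w -> y = phop w + alop (beta n y) ->
  Xn n.+1 w = t%:C *: w + t%:C *: alop w + gam%:C *: phop (beta n y).
Proof.
move=> Ww yE; set B := beta n y.
have DE u : dop' (aop u) = - aop (dop u) by rewrite dop'_dop aop_dop.
(* The equation for [y], read as: [y + B] is the Poisson kernel applied to [dop w + B]. *)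
have aQ : aop (dop w + B) = y + B.
  by rewrite (lopD bop_aop) {1}yE -/B /alop /phop addrA subrK.
have kE : gam%:C *: dop' (y + B) =
    w - (t%:C *: w + t%:C *: alop w + gam%:C *: phop B).
  rewrite -aQ (lopD bop_aop) (lopD bop_dop') (DE B) aop_dop -iterT1_dop.
  rewrite scalerDr iterT_aop /alop /phop.
  by apply: (vec_eq hn) => z; rewrite !(ipDl, ipNl, ipZl); ring.
have zE : t%:C *: w + t%:C *: alop w + gam%:C *: phop B =
    w - gam%:C *: dop' (y + B) by rewrite kE subKr.
(* For the candidate z this gives [X (dop z) = Xn n (X y)], so the resolvent equation of X_n can be
   used inside that of X_(n+1). *)
have Dz : dop (w - gam%:C *: dop' (y + B)) = X (Xn n (X y)).
  rewrite (lopB bop_dop) (lopZ bop_dop).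
  have -> : gam%:C *: dop (dop' (y + B)) = dop w + B - t%:C *: (y + B).
    rewrite -[in RHS]aQ -iterT_aop -aQ iterT1_dop; congr (_ *: _).
    by rewrite !dop'_dop (lopN bop_dop).
  apply: (vec_eq hn) => z; rewrite /B /beta !(ipDl, ipNl, ipZl).
  by rewrite rmorphN fmorphV rmorphB rmorph1; field.
have rE : y - X (Xn n (X y)) = (1 - t%:C) *: (y + B).
  apply: (vec_eq hn) => z; rewrite /B /beta !(ipDl, ipNl, ipZl).
  by rewrite rmorphN fmorphV rmorphB rmorph1; field.
apply: Xn_unique; rewrite zE.
have -> : iterT n.+1 (w - gam%:C *: dop' (y + B)) = dop' (X (iterT n (Xn n (X y)))).
  by rewrite /= Dz XK.
have E := XnP n (X y).
have -> : (wt n.+1)%:C *: dop' (X (iterT n (Xn n (X y)))) = gam%:C *: dop' (y + B).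
  rewrite wtSE -scalerA -(lopZ bop_dop') -(lopZ bX).
  have -> : (wt n)%:C *: iterT n (Xn n (X y)) = X y - Xn n (X y).
    by apply/esym/eqP; rewrite subr_eq addrC E.
  rewrite (lopB bX) XK rE (lopZ bop_dop') scalerA; congr (_ *: _).
  by rewrite gamE; field.
by rewrite subrK.
Qed.

Lemma Xn_solve n c w : centred n -> prods n n c -> 0 <= c <= t * (1 - t) -> W w ->
  exists2 y, Vset y & y = phop w + alop (beta n y).
Proof.
move=> cn hc /andP[c0 c1] Ww.
(* On [Vset] the map multiplies squared norms by c / (2 t), which the bound on [c] keeps below 1/2,
   hence below (3/4)^2. *)
apply: (@fixpoint _ _ _ (alop \o beta n) (3 / 4)) => //.
- exact: Vset_csub.
- exact: (bop_comp bop_alop (bop_beta n)).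
- by move=> x Vx; apply: alop_Vset; exact: beta_W.
- by apply/andP; split; lra.
- move=> x Vx /=.
  have Wb := beta_W cn Vx.
  have : nrm (alop (beta n x)) ^+ 2 = c / (2 * t) * nrm x ^+ 2.
    apply: complexI; rewrite -(ip_nrm hn) alop_ip// (beta_ip cn cn hc)//.
    rewrite (ip_nrm hn) (rmorphM (real_complex R) (c / (2 * t))) fmorph_div.
    by rewrite (rmorphM (real_complex R) 2) /= natC; field; rewrite tn0 t1n0.
  have : c / (2 * t) <= 1 / 2 by rewrite ler_pdivrMr ?mulr_gt0//; nra.
  move=> h1 h2; rewrite -ler_sqr ?nnegrE ?mulr_ge0 ?nrm_ge0// h2 exprMn.
  by rewrite ler_wpM2r ?sqr_ge0//; lra.
- exact: phop_Vset.
Qed.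

Lemma Xn_centred n c : centred n -> prods n n c -> 0 <= c <= t * (1 - t) -> centred n.+1.
Proof.
move=> cn hc hc' w Ww; have [y Vy yE] := Xn_solve cn hc hc' Ww.
have -> : Xn n.+1 w - t%:C *: w = t%:C *: alop w + gam%:C *: phop (beta n y).
  by rewrite (Xn_step Ww yE); apply: (vec_eq hn) => z; rewrite !(ipDl, ipNl); ring.
apply: (csub_lin _ _ Vset_csub); first exact: alop_Vset.
by apply: phop_Vset; exact: beta_W.
Qed.

(* A parabolic Moebius map, with double fixed point t (1 - t). *)
Definition cstep (c : R) : R :=
  t * (1 - t) ^+ 2 / 2 + (1 + t) ^+ 2 / 4 * c / (1 - c / (2 * t)).

Let ipDD x y x' y' : ip (x + y) (x' + y') = ip x x' + ip x y' + (ip y x' + ip y y').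
Proof. by rewrite ipDl !ipDr. Qed.

Let ip3 (a b : R) x y z x' y' z' :
  ip (a%:C *: x + a%:C *: y + b%:C *: z) (a%:C *: x' + a%:C *: y' + b%:C *: z') =
  a%:C ^+ 2 * (ip x x' + ip y y' + ip y x' + ip x y') + b%:C ^+ 2 * ip z z'
  + a%:C * b%:C * (ip x z' + ip z x' + (ip y z' + ip z y')).
Proof. by rewrite !(ipDl, ipDr, ipZl, ipZr_rc); ring. Qed.

(** The three terms of [Xn_step] are mutually orthogonal, also between the indices n and m. The
    inner product of [y] and [y'] solves a linear equation of ratio c / (2 t), the source of the
    denominator in [cstep]. *)
Lemma prods_step n m c cn cm : centred n -> prods n n cn -> 0 <= cn <= t * (1 - t) ->
  centred m -> prods m m cm -> 0 <= cm <= t * (1 - t) ->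
  prods n m c -> c < 2 * t -> prods n.+1 m.+1 (cstep c).
Proof.
move=> hn1 hn2 hn3 hm1 hm2 hm3 hc c1 w w' Ww Ww'.
have [y Vy yE] := Xn_solve hn1 hn2 hn3 Ww.
have [y' Vy' yE'] := Xn_solve hm1 hm2 hm3 Ww'.
rewrite (Xn_step Ww yE) (Xn_step Ww' yE').
have Wb := beta_W hn1 Vy; have Wb' := beta_W hm1 Vy'.
have bb := beta_ip hn1 hm1 hc Vy Vy'.
have cn0 : 2 * t%:C - c%:C != 0 :> R[i].
  have -> : 2 * t%:C - c%:C = (2 * t - c)%:C :> R[i].
    by rewrite rmorphB (rmorphM (real_complex R) 2) /= natC.
  by rewrite (_ : 0 = 0%:C)// (inj_eq (@complexI _)) gt_eqF// subr_gt0.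
have ap u u' : W u -> W u' -> ip (alop u) (phop u') = 0.
  by move=> Wu Wu'; rewrite ipC phop_alop_ip ?rmorph0.
have yy : ip y y' = 4 * t%:C ^+ 2 / (2 * t%:C - c%:C) * ip w w'.
  have : ip y y' = 2 * t%:C * ip w w' + (1 - t%:C) ^+ 2 / (2 * t%:C) * (c%:C / (1 - t%:C) ^+ 2 * ip y y').
    rewrite -bb {1}yE {1}yE' ipDD phop_ip// phop_alop_ip// ap// alop_ip//.
    by rewrite addr0 add0r.
  move=> E; apply: (mulfI cn0); apply: (@mulfI _ (2 * t%:C)^-1).
    by rewrite invr_neq0// mulf_neq0// pnatr_eq0.
  have -> : (2 * t%:C)^-1 * ((2 * t%:C - c%:C) * ip y y') =
     ip y y' - (1 - t%:C) ^+ 2 / (2 * t%:C) * (c%:C / (1 - t%:C) ^+ 2 * ip y y').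
    by field; rewrite t1n0 tn0.
  by rewrite {1}E addrK; field; rewrite tn0 cn0.
have aw u u' : W u -> W u' -> ip (alop u) u' = 0.
  by move=> Wu Wu'; case: (alop_Vset Wu) => _ h _; exact: h.
have pw u u' : W u -> W u' -> ip (phop u) u' = 0.
  by move=> Wu Wu'; case: (phop_Vset Wu) => _ h _; exact: h.
have wa u u' : W u -> W u' -> ip u' (alop u) = 0 by move=> Wu Wu'; rewrite ipC aw ?rmorph0.
have wp u u' : W u -> W u' -> ip u' (phop u) = 0 by move=> Wu Wu'; rewrite ipC pw ?rmorph0.
rewrite ip3 (aw _ _ Ww Ww') (pw _ _ Wb Ww') (wa _ _ Ww' Ww) (wp _ _ Wb' Ww) (ap _ _ Ww Wb').
rewrite (phop_alop_ip Wb Ww') (alop_ip Ww Ww') (phop_ip Wb Wb') bb yy gamE /cstep.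
have -> : (t * (1 - t) ^+ 2 / 2 + (1 + t) ^+ 2 / 4 * c / (1 - c / (2 * t)))%:C =
   t%:C * (1 - t%:C) ^+ 2 / 2 + (1 + t%:C) ^+ 2 / 2 * c%:C * t%:C / (2 * t%:C - c%:C) :> R[i].
  have h : 2 * t - c != 0 by rewrite gt_eqF// subr_gt0.
  have -> : t * (1 - t) ^+ 2 / 2 + (1 + t) ^+ 2 / 4 * c / (1 - c / (2 * t)) =
      t * (1 - t) ^+ 2 / 2 + (1 + t) ^+ 2 / 2 * c * t / (2 * t - c).
    by field; rewrite h gt_eqF.
  by rewrite !(rmorph_nat, rmorph1, rmorphXn, rmorphB, rmorphD, fmorph_div, rmorphM).
by field; rewrite tn0 cn0 t1n0.
Qed.

(** * The orbit of 0 under the Moebius map *)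

Definition vv n : R := n%:R * t * (1 - t) ^+ 2 / (1 + t + n%:R * (1 - t)).

Let den n : 0 < 1 + t + n%:R * (1 - t).
Proof.
apply: ltr_wpDr; last by rewrite addr_gt0.
by apply: mulr_ge0 => //; rewrite subr_ge0 ltW.
Qed.

(** A parabolic map is a translation in the coordinate 1 / (t (1 - t) - v); accordingly the inverse
    of the gap is affine in n. *)
Lemma vvE n : vv n = t * (1 - t) - t * (1 - t) * (1 + t) / (1 + t + n%:R * (1 - t)).
Proof. by rewrite /vv; field; rewrite gt_eqF. Qed.

Lemma vv_bound n : 0 <= vv n <= t * (1 - t).
Proof.
apply/andP; split.
  rewrite /vv; apply: divr_ge0; last exact: ltW.
  by rewrite mulr_ge0 ?sqr_ge0// mulr_ge0// ltW.
rewrite vvE gerBl; apply: divr_ge0; last exact: ltW.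
by move: t0 t1 => ? ?; rewrite mulr_ge0 ?mulr_ge0//; lra.
Qed.

Lemma vv_step n : cstep (vv n) = vv n.+1.
Proof.
have d0 := den n; have d1 := den n.+1.
have h : 0 < (1 + t + n%:R * (1 - t)) * 2 - n%:R * (1 - t) ^+ 2.
  have -> : (1 + t + n%:R * (1 - t)) * 2 - n%:R * (1 - t) ^+ 2 =
      (1 + t) * 2 + n%:R * ((1 - t) * (1 + t)) by ring.
  by apply: ltr_wpDr; move: t0 t1 => ? ?; rewrite ?mulr_gt0 ?mulr_ge0//; lra.
rewrite /cstep /vv; move: d1; rewrite -natr1 => d1.
by field; rewrite (gt_eqF d0) (gt_eqF d1) (gt_eqF h) gt_eqF.
Qed.

Lemma Xn0 w : Xn 0 w = t%:C *: w.
Proof.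
apply: Xn_unique; rewrite /= wt0E; apply: (vec_eq hn) => z.
by rewrite !(ipDl, ipZl); field.
Qed.

Lemma centred0 : centred 0.
Proof.
by move=> w _; rewrite Xn0 subrr; have [] := Vset_csub.
Qed.

Lemma prods0 m : centred m -> prods 0 m 0.
Proof.
move=> cm w w' Ww Ww'; rewrite Xn0 ipZl ipC (centred_ip cm)// rmorphM /= conj_rc -ipC.
by rewrite rmorph0 addr0 mulrA.
Qed.

Lemma Xn_centred_prods n : centred n /\ prods n n (vv n).
Proof.
elim: n => [|n [cn hn1]].
  split; first exact: centred0.
  by have := prods0 centred0; rewrite /vv !mul0r.
have cn1 := Xn_centred cn hn1 (vv_bound n).
split => //; rewrite -vv_step; apply: (prods_step cn hn1 _ cn hn1) => //; try exact: vv_bound.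
by have /andP[_ b] := vv_bound n; apply: le_lt_trans b _; move: t0 t1 => ? ?; nra.
Qed.

(** The martingale property. Both indices go down together until the smaller one is 0, where X_0 is
    the scalar [t] and the covariance vanishes. *)
Lemma prods_le n m : (n <= m)%N -> prods n m (vv n).
Proof.
elim: n m => [|n IH] [|m] // nm.
- by have := prods0 centred0; rewrite /vv !mul0r.
- by have := prods0 (Xn_centred_prods m.+1).1; rewrite /vv !mul0r.
have [cn hn1] := Xn_centred_prods n; have [cm hm1] := Xn_centred_prods m.
rewrite -vv_step; apply: (prods_step cn hn1 _ cm hm1) => //; try exact: vv_bound.
  exact: IH.
by have /andP[_ b] := vv_bound n; apply: le_lt_trans b _; move: t0 t1 => ? ?; nra.
Qed.

(** With [w = xi] and [e = Z xi] this says tau (Z X_n) = 0, so F_11 and F_22 will share the trace of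
    the limit equally. *)
Lemma Xn_e n w : W w -> ip w e = 0 -> ip (Xn n w) e = 0.
Proof.
move=> Ww we; have [_ _] := (Xn_centred_prods n).1 w Ww.
by rewrite ipBl ipZl we mulr0 subr0.
Qed.

Lemma Xn_tr n w : W w -> ip (Xn n w) w = t%:C * ip w w.
Proof. by move=> Ww; apply: centred_ip => //; case: (Xn_centred_prods n). Qed.

(** * Convergence of the martingale on [W] *)

Lemma Xn_dist n m w : (n <= m)%N -> W w ->
  nrm (Xn m w - Xn n w) ^+ 2 = (vv m - vv n) * nrm w ^+ 2.
Proof.
move=> nm Ww; apply: complexI; rewrite -(ip_nrm hn) ipBl !ipBr.
have E : ip (Xn m w) (Xn n w) = (t%:C ^+ 2 + (vv n)%:C) * ip w w.
  rewrite ipC (prods_le nm)// (ip_nrm hn) -rmorphXn -rmorphD.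
  by rewrite -(rmorphM (real_complex R) (t ^+ 2 + vv n)) conj_rc.
rewrite E (prods_le nm)// (Xn_centred_prods m).2// (Xn_centred_prods n).2//.
rewrite (ip_nrm hn) (rmorphM (real_complex R) (vv m - vv n)) rmorphB.
ring.
Qed.

Lemma vv_gap n N : (N <= n)%N -> t * (1 - t) - vv n <= (1 - t)^-1 / N.+1%:R.
Proof.
move=> Nn; rewrite vvE subKr.
rewrite ler_pdivrMr// -invfM ler_pdivlMl ?mulr_gt0 ?subr_gt0//.
have nN : N.+1%:R <= n.+1%:R :> R by rewrite ler_nat.
rewrite -[n.+1%:R]natr1 in nN.
move: nN; move: (N.+1%:R) (n%:R : R) (ler0n R N.+1) => a c a0 ac; move: t0 t1 => h0 h1.
have i0 : t * (1 - t) * (1 + t) <= 1 by nra.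
have i1 : (1 - t) * a * (t * (1 - t) * (1 + t)) <= (1 - t) * a * 1.
  by apply: ler_wpM2l i0; rewrite mulr_ge0//; lra.
apply: le_trans i1 _; nra.
Qed.

Lemma Xn_cauchy w : W w -> exists l, cvs (fun n => Xn n w) l.
Proof.
move=> Ww; apply: cvs_complete => eps e0.
have [N hN] : exists N, (1 - t)^-1 * nrm w ^+ 2 * N.+1%:R^-1 < eps ^+ 2.
  have B0 : 0 <= (1 - t)^-1 * nrm w ^+ 2.
    by rewrite mulr_ge0 ?sqr_ge0// invr_ge0 subr_ge0 ltW.
  move: (_ * _) B0 => B B0; have B1 : 0 < B + 1 by rewrite ltr_wpDl.
  have p : 0 < eps ^+ 2 / (B + 1) by rewrite divr_gt0 ?exprn_gt0.
  have [N hN] := ltr_add_invr p; exists N.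
  rewrite add0r ltr_pdivlMr// in hN; apply: le_lt_trans hN.
  by rewrite mulrC ler_wpM2l// lerDl.
have key m n : (N <= n)%N -> (n <= m)%N -> nrm (Xn m w - Xn n w) < eps.
  move=> Nn nm; rewrite -ltr_sqr ?nnegrE ?nrm_ge0 ?ltW// (Xn_dist nm Ww).
  apply: le_lt_trans hN; rewrite mulrAC ler_wpM2r ?sqr_ge0//.
  have /andP[_ b] := vv_bound m; by apply: le_trans (vv_gap Nn); rewrite lerD2r.
exists N => m n Nm Nn; have [nm|/ltnW mn] := leqP n m; first exact: key.
by rewrite nrmBC; exact: key.
Qed.

End Martingale.

(** * The two copies of the matrix algebra *)

Section FreeProduct.
Context {R : realType} {H : completeNormedModType R[i]}.
Variables (ip : {dot H for Num.conj}) (M : set (H -> H)).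
Variables (tau : (H -> H) -> R[i]) (xi : H) (emb : bool -> 'M[R[i]]_2 -> H -> H).
Hypothesis hM : free_product_M2 ip M tau xi emb.
Implicit Types (x y z : H) (T A B : H -> H) (K : set H) (a c : 'M[R[i]]_2).

Let hn : hilbert_norm ip := fp_hilbert hM.

Lemma emb_bop b a : bop (emb b a).
Proof. exact/bopP/(star_bounded (fp_morphism hM b)). Qed.
Lemma embM b a c x : emb b a (emb b c x) = emb b (a *m c) x.
Proof. by rewrite (star_mul (fp_morphism hM b)). Qed.
Lemma embD b a c x : emb b (a + c) x = emb b a x + emb b c x.
Proof.
by have := star_linear (fp_morphism hM b) 1 a c; rewrite !scale1r => ->; rewrite fctE.
Qed.
Lemma embZ b (k : R[i]) a x : emb b (k *: a) x = k *: emb b a x.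
Proof.
have e0 : emb b 0 x = 0.
  by apply: (addrI (emb b 0 x)); rewrite -embD !addr0.
have := star_linear (fp_morphism hM b) k a 0; rewrite addr0 => ->.
by rewrite fctE e0 addr0 fctE.
Qed.
Lemma emb1 b x : emb b 1%:M x = x.
Proof. by rewrite (star_one (fp_morphism hM b)). Qed.
Lemma emb_adj b a : adjoint_of ip (emb b a) (emb b (map_mx Num.conj a^T)).
Proof. exact: star_adjoint (fp_morphism hM b) a. Qed.

(** * The von Neumann algebra [M] *)

Let gens := \bigcup_b range (emb b).
Definition comm : set (H -> H) := commutant gens.

Lemma comm_bop S : comm S -> bop S.
Proof. by case=> /bopP. Qed.

Lemma commP S : comm S <-> bop S /\ forall b a x, S (emb b a x) = emb b a (S x).
Proof.
split=> [[bS hS]|[bS hS]]; split; try exact/bopP.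
  move=> b a x; have := hS (emb b a).
  by move=> /(_ _)/(congr1 (fun f => f x)); apply; exists b => //; exists a.
by move=> _ [b _ [a _ <-]]; apply/funext => x; exact: hS.
Qed.

Lemma memM T : M T <-> bop T /\ forall S, comm S -> forall x, T (S x) = S (T x).
Proof.
rewrite (fp_generated hM); split=> [[bT hT]|[bT hT]]; split; try exact/bopP.
  by move=> S cS x; have := hT S cS => /(congr1 (fun f => f x)).
by move=> S cS; apply/funext => x; exact: hT.
Qed.

Lemma comm_adj S : comm S -> exists2 S', comm S' & adjoint_of ip S S'.
Proof.
move=> /commP[bS hS]; have [S' bS' aS] := adj_exists hn bS; exists S' => //.
apply/commP; split => // b a x; apply: (vec_eq hn) => z.
rewrite (adj_sym aS) (emb_adj b a (S' x)) (emb_adj b a x) (adj_sym aS).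
by rewrite hS.
Qed.

Lemma M_bop T : M T -> bop T. Proof. by move=> /memM[]. Qed.

Lemma M_emb b a : M (emb b a).
Proof.
apply/memM; split=> [|S /commP[_ hS] x]; first exact: emb_bop.
by rewrite hS.
Qed.

Lemma M_comp S T : M S -> M T -> M (fun x => S (T x)).
Proof.
move=> /memM[bS hS] /memM[bT hT]; apply/memM; split; first exact: (bop_comp bS bT).
by move=> U cU x; rewrite hT// hS.
Qed.

Lemma M_add S T : M S -> M T -> M (fun x => S x + T x).
Proof.
move=> /memM[bS hS] /memM[bT hT]; apply/memM; split; first exact: bop_add.
by move=> U cU x; rewrite hT// hS// (lopD (comm_bop cU)).
Qed.

Lemma M_scale (k : R[i]) T : M T -> M (fun x => k *: T x).
Proof.
move=> /memM[bT hT]; apply/memM; split; first exact: bop_scale.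
by move=> U cU x; rewrite hT// (lopZ (comm_bop cU)).
Qed.

Lemma M_sub S T : M S -> M T -> M (fun x => S x - T x).
Proof.
move=> mS mT; have := M_add mS (M_scale (-1) mT); congr M.
by apply/funext => x; rewrite scaleN1r.
Qed.

Lemma M_id : M idfun.
Proof. by apply/memM; split => //; exact: bop_id. Qed.

Lemma M_adj T : M T -> exists2 T', M T' & adjoint_of ip T T'.
Proof.
move=> /memM[bT hT]; have [T' bT' aT] := adj_exists hn bT; exists T' => //.
apply/memM; split => // S cS x; have [S' cS' aS] := comm_adj cS.
apply: (vec_eq hn) => z.
by rewrite (adj_sym aT) aS aS (adj_sym aT) hT.
Qed.

Lemma M_adj_of T T' : M T -> adjoint_of ip T T' -> M T'.
Proof.
by move=> mT aT; have [T'' mT'' aT'] := M_adj mT; rewrite (adj_unique hn aT aT').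
Qed.

(** The commutant of the generators is closed under adjoints, so an invariant range is reducing and
    [P] commutes with that commutant. *)
Lemma M_proj K P : csub K -> (forall S x, comm S -> K x -> K (S x)) ->
  orth_proj ip K P -> M P.
Proof.
move=> cK hK hP; have [bP KP oP] := hP; apply/memM; split => // S cS x.
have [S' cS' aS] := comm_adj cS.
have sP := orth_proj_sa hP.
have PSP U y : comm U -> P (U (P y)) = U (P y).
  by move=> cU; apply: (orth_proj_id hn hP); exact: hK.
rewrite -(PSP S x cS); apply: (vec_eq hn) => z.
by rewrite !sP !aS sP (PSP S' z cS').
Qed.

Lemma M_res A : M A -> positive ip A -> M (res A).
Proof.
move=> /memM[bA hA] pA; apply/memM; split; first exact: (bop_res hn bA pA).
by move=> S cS x; rewrite -(res_comm hn bA pA (comm_bop cS))// => y; rewrite hA.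
Qed.

Definition tr T : R[i] := ip (T xi) xi.

Lemma tauE T : M T -> tau T = tr T.
Proof. exact: (L2_state (fp_L2 hM)). Qed.

Lemma xi1 : ip xi xi = 1. Proof. exact: (L2_unit (fp_L2 hM)). Qed.
Lemma trC S T : M S -> M T -> ip (S (T xi)) xi = ip (T (S xi)) xi.
Proof.
move=> mS mT; have := trace_tracial (fp_trace hM) mS mT.
by rewrite !tauE //; exact: M_comp.
Qed.

(** The vector [xi] is separating, since S xi = 0 gives tau (S^* S) = 0 and the trace is
    faithful. *)
Lemma sep S x : M S -> S xi = 0 -> S x = 0.
Proof.
move=> mS S0; have [S' mS' aS] := M_adj mS.
have := trace_faithful (fp_trace hM) mS mS' aS.
rewrite tauE /tr /=; last exact: M_comp.
rewrite S0 (lop0 (M_bop mS')) ip0l => /(_ erefl) -> //.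
Qed.

Lemma cyclic x (e : R) : 0 < e -> exists2 T, M T & nrm (x - T xi) < e.
Proof.
move=> e0; have : closure [set T xi | T in M] x.
  by rewrite (L2_cyclic (fp_L2 hM)).
have e0' : (0 : R[i]) < e%:C by rewrite ltcR.
move=> /(_ _ (nbhsx_ballx x _ e0')) [_ [[T mT <-]]].
by rewrite -ball_normE /= nrmE ltcR => h; exists T.
Qed.

(** * Reduced words *)

Definition letter := (bool * 'M[R[i]]_2)%type.
Definition act (w : seq letter) x : H := foldr (fun l y => emb l.1 l.2 y) x w.
Definition reduced (w : seq letter) : bool :=
  sorted (fun l l' => l.1 != l'.1) w && all (fun l => \tr l.2 == 0) w.
Definition adjl (l : letter) : letter := (l.1, map_mx Num.conj (l.2)^T).
Definition adjw (w : seq letter) := rev (map adjl w).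

Lemma act_cat w w' x : act (w ++ w') x = act w (act w' x).
Proof. by rewrite /act foldr_cat. Qed.

Lemma act_adj w x y : ip x (act w y) = ip (act (adjw w) x) y.
Proof.
elim: w x => //= l w IH x.
by rewrite /adjw /= rev_cons -cats1 act_cat /= -IH (adj_sym (emb_adj _ _)).
Qed.

Lemma tr_adj (a : 'M[R[i]]_2) : \tr a = 0 -> \tr (map_mx Num.conj a^T) = 0.
Proof.
move=> h; have -> : \tr (map_mx Num.conj a^T) = Num.conj (\tr a).
  by rewrite /mxtrace rmorph_sum; apply: eq_bigr => i _; rewrite !mxE.
by rewrite h rmorph0.
Qed.

Lemma reduced_adjw w : reduced w -> reduced (adjw w).
Proof.
move=> /andP[h1 h2]; apply/andP; split; last first.
  rewrite all_rev all_map; apply: sub_all h2 => l /= /eqP h.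
  by apply/eqP; exact: tr_adj.
rewrite /adjw rev_sorted sorted_map; apply: sub_sorted h1 => l l' /=.
by rewrite eq_sym.
Qed.

Lemma reduced_cat w w' : reduced w -> reduced w' ->
  (forall l l' v v', w = rcons v l -> w' = l' :: v' -> l.1 != l'.1) ->
  reduced (w ++ w').
Proof.
move=> /andP[s1 t1] /andP[s2 t2] h; rewrite /reduced all_cat t1 t2 !andbT.
case: w' s2 {t2} h => [|l' v'] s2 h; first by rewrite cats0.
case/lastP: w s1 {t1} h => [|v l] s1 h //.
rewrite cat_rcons; move: s1 s2; case: v h => [|l0 v] h /=.
  by move=> _ ->; rewrite (h _ _ [::] _ erefl erefl).
rewrite rcons_path cat_path /= => /andP[-> ->] /= ->.
by rewrite (h _ _ (l0 :: v) _ erefl erefl).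
Qed.

Lemma big_act (w : seq letter) :
  \big[(fun S S' => S \o S')/idfun]_(0 <= k < size w)
     emb (nth (false, 0) w k).1 (nth (false, 0) w k).2 = act w.
Proof.
elim: w => [|l w IH]; first by rewrite big_nil.
rewrite big_ltn//= big_add1 /= IH.
by [].
Qed.

Lemma M_act w : M (act w).
Proof.
elim: w => [|l w IH] /=; first exact: M_id.
exact: (M_comp (M_emb _ _) IH).
Qed.

Lemma act_tr w : w != [::] -> reduced w -> ip (act w xi) xi = 0.
Proof.
move=> w0 /andP[sw tw].
have := fp_free hM (i := fun k => (nth (false, 0) w k).1)
  (T := fun k => emb (nth (false, 0) w k).1 (nth (false, 0) w k).2) (n := size w).
rewrite big_act tauE; last exact: M_act.
apply; first by rewrite lt0n size_eq0.
- move=> k kw; split; first by exists (nth (false, 0) w k).2.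
  rewrite (fp_state hM); have /allP /(_ _ (mem_nth (false, 0) kw)) /eqP -> := tw.
  by rewrite mulr0.
- by move=> k kw; move/sortedP: sw => /(_ (false, 0)); apply.
Qed.

(** The condition on the first letters says that [adjw w' ++ w] is reduced; freeness makes its trace
    0. *)
Lemma ip_act w w' : reduced w -> reduced w' ->
  (forall l l' v v', w = l :: v -> w' = l' :: v' -> l.1 != l'.1) ->
  (w != [::]) || (w' != [::]) ->
  ip (act w xi) (act w' xi) = 0.
Proof.
move=> rw rw' h w0; rewrite act_adj -act_cat act_tr//.
  by rewrite -size_eq0 size_cat size_rev size_map addn_eq0 !size_eq0 negb_and orbC.
apply: reduced_cat => //; first exact: reduced_adjw.
move=> l l' v v' e1 e2; rewrite eq_sym.
have e3 : map adjl w' = l :: rev v.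
  by rewrite -[map _ _]revK -/(adjw w') e1 rev_rcons.
case: w' e3 {rw' h w0 e1} (h) => [|l'' w''] //= [e _] h'.
by rewrite -e /=; apply: (h' _ _ _ _ e2 erefl).
Qed.

(** * The symmetries U, Z, X and the unitary V *)

Definition mZ : 'M[R[i]]_2 := delta_mx 0 0 - delta_mx 1 1.
Definition mX : 'M[R[i]]_2 := delta_mx 0 1 + delta_mx 1 0.

Lemma mx2P a c : a 0 0 = c 0 0 -> a 0 1 = c 0 1 -> a 1 0 = c 1 0 -> a 1 1 = c 1 1 -> a = c.
Proof.
move=> h1 h2 h3 h4; apply/matrixP => i j.
have o (k : 'I_2) : k = 0 \/ k = 1.
  by case: k => -[|[|//]] h; [left|right]; apply/val_inj.
by case: (o i) => ->; case: (o j) => ->.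
Qed.

Lemma mulmx2E a c i j : (a *m c) i j = a i 0 * c 0 j + a i 1 * c 1 j.
Proof.
rewrite mxE big_ord_recl big_ord1.
by congr (_ * _ + a i _ * c _ j); apply/val_inj.
Qed.

Lemma mxtr2E a : \tr a = a 0 0 + a 1 1.
Proof. by rewrite /mxtrace big_ord_recl big_ord1; congr (_ + a _ _); apply/val_inj. Qed.

Let simp := (mulmx2E, mxtr2E, mxE).

Lemma mZZ : mZ *m mZ = 1%:M.
Proof. by apply: mx2P; rewrite !simp /=; ring. Qed.
Lemma mXX : mX *m mX = 1%:M.
Proof. by apply: mx2P; rewrite !simp /=; ring. Qed.
Lemma mXZ : mX *m mZ = - (mZ *m mX).
Proof. by apply: mx2P; rewrite !simp /=; ring. Qed.
Lemma tr_mZ : \tr mZ = 0.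
Proof. by rewrite !simp /=; ring. Qed.

Definition U := emb false mZ.
Definition Z := emb true mZ.
Definition X := emb true mX.
Definition V x := U (Z x).
Definition V' x := Z (U x).

Lemma adj_mZ : map_mx Num.conj mZ^T = mZ.
Proof.
by apply: mx2P; rewrite !simp rmorphB !rmorph_nat ?andbF.
Qed.
Lemma adj_mX : map_mx Num.conj mX^T = mX.
Proof.
by apply: mx2P; rewrite !simp rmorphD !rmorph_nat ?andbF // addrC.
Qed.

Lemma UK : involutive U. Proof. by move=> x; rewrite /U embM mZZ emb1. Qed.
Lemma ZK : involutive Z. Proof. by move=> x; rewrite /Z embM mZZ emb1. Qed.
Lemma XK : involutive X. Proof. by move=> x; rewrite /X embM mXX emb1. Qed.
Lemma aU : adjoint_of ip U U.
Proof. by have := emb_adj false mZ; rewrite adj_mZ. Qed.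
Lemma aZ : adjoint_of ip Z Z.
Proof. by have := emb_adj true mZ; rewrite adj_mZ. Qed.
Lemma aX : adjoint_of ip X X.
Proof. by have := emb_adj true mX; rewrite adj_mX. Qed.
Lemma bU : bop U. Proof. exact: emb_bop. Qed.
Lemma bZ : bop Z. Proof. exact: emb_bop. Qed.
Lemma bX : bop X. Proof. exact: emb_bop. Qed.
Lemma bV : bop V. Proof. exact: (bop_comp bU bZ). Qed.
Lemma bV' : bop V'. Proof. exact: (bop_comp bZ bU). Qed.
Lemma VK : cancel V V'. Proof. by move=> x; rewrite /V /V' UK ZK. Qed.
Lemma V'K : cancel V' V. Proof. by move=> x; rewrite /V /V' ZK UK. Qed.
Lemma aV : adjoint_of ip V V'. Proof. by move=> x y; rewrite aU aZ. Qed.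

Lemma embN b a x : emb b (- a) x = - emb b a x.
Proof. by rewrite -scaleN1r embZ scaleN1r. Qed.

Lemma XZ x : X (Z x) = - Z (X x).
Proof. by rewrite /X /Z !embM mXZ embN. Qed.

(* Nontrivial reduced words with first letter in the first, resp. second copy
   of M_2; [wX] generates a wandering subspace of [V]. *)
Definition wU : set H :=
  [set u | exists a w, reduced ((false, a) :: w) /\ u = act ((false, a) :: w) xi].
Definition wF : set H :=
  [set u | exists a w, reduced ((true, a) :: w) /\ u = act ((true, a) :: w) xi].
Definition wX : set H :=
  [set s | s = xi \/ exists a w, [/\ a 0 0 = 0, a 1 1 = 0,
     reduced ((true, a) :: w) & s = act ((true, a) :: w) xi]].

Lemma wU_xi u : wU u -> ip u xi = 0.
Proof. by move=> [a [w [rw ->]]]; exact: act_tr. Qed.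

Lemma wU_wF u u' : wU u -> wF u' -> ip u u' = 0.
Proof.
move=> [a [w [rw ->]]] [a' [w' [rw' ->]]]; apply: ip_act => //.
by move=> l l' v v' [<- _] [<- _].
Qed.

Lemma wU_wX u s : wU u -> wX s -> ip u s = 0.
Proof.
move=> hu [->|[a [w [_ _ rw ->]]]]; first exact: wU_xi.
by apply: (wU_wF hu); exists a, w.
Qed.

Lemma reduced_cons l w : \tr l.2 = 0 -> reduced w ->
  (forall l' v, w = l' :: v -> l.1 != l'.1) -> reduced (l :: w).
Proof.
move=> tl /andP[s tw] h; rewrite /reduced /= tw tl eqxx !andbT.
by case: w s {tw} h => [|l' v] //= -> /(_ _ _ erefl) ->.
Qed.

Lemma U_wF u : wF u -> wU (U u).
Proof.
move=> [a [w [rw ->]]]; exists mZ, ((true, a) :: w); split => //.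
by apply: reduced_cons => //=; [exact: tr_mZ|move=> l' v [<- _]].
Qed.

Lemma U_xi : wU (U xi).
Proof. by exists mZ, [::]; split => //; apply: reduced_cons => //; exact: tr_mZ. Qed.

Lemma U_wX s : wX s -> wU (U s).
Proof.
move=> [->|[a [w [_ _ rw ->]]]]; first exact: U_xi.
by apply: U_wF; exists a, w.
Qed.

Lemma emb_wU c u : \tr c = 0 -> wU u -> wF (emb true c u).
Proof.
move=> tc [a [w [rw ->]]]; exists c, ((false, a) :: w); split => //.
by apply: reduced_cons => //= l' v [<- _].
Qed.

(** This is the purpose of the off-diagonal first letters in [wX]: multiplied by the diagonal [mZ]
    they stay off-diagonal, hence centred, and the word stays reduced. *)
Lemma Z_wX s : wX s -> wF (Z s).
Proof.
move=> [->|[a [w [a0 a1 rw ->]]]].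
  by exists mZ, [::]; split => //; apply: reduced_cons => //; exact: tr_mZ.
exists (mZ *m a), w; split; last by rewrite /= /Z embM.
move: rw => /andP[/= sw /andP[_ tw]]; apply/andP; split => /=; first by case: (w) sw.
apply/andP; split => //.
by rewrite !simp a0 a1 /=; apply/eqP; ring.
Qed.

Lemma iterV_wU k s : wX s -> wU (iter k.+1 V s).
Proof.
move=> hs; elim: k => [|k IH]; first by apply: U_wF; exact: Z_wX.
by rewrite iterS; apply: U_wF; apply: emb_wU => //; exact: tr_mZ.
Qed.

Lemma iterV'_wU k s : wX s -> exists2 u, wU u & iter k.+1 V' s = Z u.
Proof.
move=> hs; elim: k => [|k [u hu e]]; first by exists (U s) => //; exact: U_wX.
rewrite iterS e; exists (U (Z u)) => //; apply: U_wF; apply: emb_wU => //; exact: tr_mZ.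
Qed.

Lemma iterV_orth k s s' : wX s -> wX s' -> ip (iter k.+1 V s) s' = 0.
Proof. by move=> hs; apply: wU_wX; exact: iterV_wU. Qed.

Lemma X_iterV k s : wX s -> wX (X (iter k.+1 V s)).
Proof.
move=> /(iterV_wU k) [a [w [rw ->]]]; right; exists mX, ((false, a) :: w).
split; rewrite ?simp //=; try ring.
apply: reduced_cons => //= [|l' v [<- _] //].
by rewrite !simp /=; ring.
Qed.

(** The leading [Z] of a negative power merges with [X] into the off-diagonal letter [mX *m mZ]. *)
Lemma X_iterV' k s : wX s -> wX (X (iter k.+1 V' s)).
Proof.
move=> /(iterV'_wU k) [_ [a [w [rw ->]]] ->]; right; exists (mX *m mZ), ((false, a) :: w).
split; rewrite ?simp //=; try ring; last by rewrite /X /Z !embM.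
apply: reduced_cons => //= [|l' v [<- _] //].
by rewrite !simp /=; ring.
Qed.

Lemma iterV_e k s : wX s -> ip (iter k.+1 V s) (Z xi) = 0.
Proof.
by move=> /(iterV_wU k) h; apply: (wU_wF h); apply: Z_wX; left.
Qed.

Lemma iterV'_e k s : wX s -> ip (iter k.+1 V' s) (Z xi) = 0.
Proof.
by move=> /(iterV'_wU k) [u hu ->]; rewrite aZ ZK wU_xi.
Qed.

Lemma xi_e : ip xi (Z xi) = 0.
Proof. by rewrite -aZ; apply: (@act_tr [:: (true, mZ)]) => //; apply: reduced_cons => //; exact: tr_mZ. Qed.

End FreeProduct.

(** * Limits of inner products, null vectors of positive operators *)

Section Limits.
Context {R : realType} {H : completeNormedModType R[i]}.
Variable ip : {dot H for Num.conj}.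
Hypothesis hn : hilbert_norm ip.
Implicit Types (x y z : H) (B : H -> H).

Lemma cvs_lin (a : R[i]) (u v : nat -> H) l k : cvs u l -> cvs v k ->
  cvs (fun n => a *: u n + v n) (a *: l + k).
Proof.
move=> ul vk e e0.
have a1 : 0 < cab a + 1 by rewrite ltr_wpDl// cab_ge0.
have e2 : 0 < e / 2 by lra.
have [N1 h1] := ul _ (divr_gt0 e2 a1); have [N2 h2] := vk _ e2.
exists (maxn N1 N2) => n; rewrite geq_max => /andP[/h1 + /h2 i2].
rewrite ltr_pdivlMr// => i1.
have -> : a *: u n + v n - (a *: l + k) = a *: (u n - l) + (v n - k).
  by rewrite scalerBr opprD addrACA.
apply: le_lt_trans (nrmD _ _) _; rewrite nrmZ.
have := nrm_ge0 (u n - l); have := cab_ge0 a; nra.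
Qed.

Lemma cvs_rip (u v : nat -> H) l k : cvs u l -> cvs v k ->
  (fun n => rip ip (u n) (v n)) @ \oo --> rip ip l k.
Proof.
move=> ul vk; apply/cvgrPdist_lt => e e0.
pose B := nrm k + nrm l + 1.
have B0 : 0 < B by rewrite ltr_wpDl// addr_ge0// nrm_ge0.
have d0 : 0 < Num.min 1 (e / B) by rewrite lt_min ltr01 divr_gt0.
have [N1 h1] := ul _ d0; have [N2 h2] := vk _ d0.
exists (maxn N1 N2) => // n /=; rewrite geq_max => /andP[/h1 i1 /h2 i2].
have -> : rip ip l k - rip ip (u n) (v n) =
    - rip ip (u n - l) k - rip ip l (v n - k) - rip ip (u n - l) (v n - k).
  by rewrite !ripDl !ripNl !(ripC ip _ (v n - k)) !ripDl !ripNl !(ripC ip (v n)) !(ripC ip k); ring.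
have b1 := rip_CS hn (u n - l) k; have b2 := rip_CS hn l (v n - k).
have b3 := rip_CS hn (u n - l) (v n - k).
move: i1 i2; rewrite !lt_min !ltr_pdivlMr// => /andP[i1 i1'] /andP[i2 i2'].
apply: le_lt_trans (ler_normB _ _) _.
apply: le_lt_trans (lerD (ler_normB _ _) (lexx _)) _; rewrite normrN.
have := nrm_ge0 (u n - l); have := nrm_ge0 (v n - k); have := nrm_ge0 k; have := nrm_ge0 l.
move: b1 b2 b3 i1 i2 i1' i2'; rewrite /B.
move: (nrm (u n - l)) (nrm (v n - k)) (nrm k) (nrm l) => a b c d.
move: `|rip ip (u n - l) k| `|rip ip l (v n - k)| `|rip ip (u n - l) (v n - k)| => r1 r2 r3.
move=> b1 b2 b3 i1 i2 i1' i2' d'0 c0 b0 a0.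
have [ab|ba] := leP a b; [have := i2'|have := i1']; nra.
Qed.

Lemma cvs_shift (u : nat -> H) l : cvs u l -> cvs (fun n => u n.+1) l.
Proof. by move=> h e /h [N hN]; exists N => n Nn; apply: hN; exact: leqW. Qed.

Lemma cvs_cst x : cvs (fun=> x) x.
Proof. by move=> e e0; exists 0%N => n _; rewrite subrr nrm0. Qed.

Lemma positive_null B x : bop B -> positive ip B -> rip ip (B x) x = 0 -> B x = 0.
Proof.
move=> bB [sB pB] h.
apply: nrm_eq0; apply/eqP; rewrite -sqrf_eq0; apply/eqP.
set N := nrm (B x) ^+ 2; have N0 : 0 <= N := sqr_ge0 _.
set c := rip ip (B (B x)) (B x); have c0 : 0 <= c := pB _.
(* Positivity at x - s B x reads 0 <= s (s c - 2 N); this [s] has s c <= N, which forces N = 0. *)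
pose s := N / (c + 1).
have c1 : 0 < c + 1 by lra.
have sc : s * (c + 1) = N by rewrite /s mulfVK// gt_eqF.
have := pB (x - s%:C *: B x).
rewrite (lopB bB) (lopZ bB) ripDl ripNl ripZl (ripC ip (B x)) (ripC ip (B (B x))).
rewrite !ripDl !ripNl !ripZl (ripC ip x) h (rip_nrm hn) -/N (ripC ip (B x)) -/c.
have -> : rip ip x (B (B x)) = N by rewrite /rip -sB -/(rip ip _ _) (rip_nrm hn).
rewrite /c in sc c0 *; move=> i.
have s0 : 0 <= s by rewrite divr_ge0// ltW.
nra.
Qed.

End Limits.

(** * The resolvents inside the free product *)

Section Limit.
Context {R : realType} {H : completeNormedModType R[i]}.
Variables (ip : {dot H for Num.conj}) (M : set (H -> H)).
Variables (tau : (H -> H) -> R[i]) (xi : H) (emb : bool -> 'M[R[i]]_2 -> H -> H).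
Hypothesis hM : free_product_M2 ip M tau xi emb.
Implicit Types (x y z : H) (T A B : H -> H) (K : set H).
Variable t : R.
Hypothesis ht : 0 < t < 1.

Let hn : hilbert_norm ip := fp_hilbert hM.
Local Notation U := (U emb).
Local Notation Z := (Z emb).
Local Notation X := (X emb).
Local Notation V := (V emb).
Local Notation V' := (V' emb).
Local Notation Xn := (Xn X V V' t).
Local Notation iterT := (iterT X V V').
Local Notation dop := (dop V V').
Local Notation dop' := (dop' V V').

Let bXn n : bop (Xn n) := bop_Xn hn (bX hM) (aX hM) (bV hM) (bV' hM) (aV hM) ht n.
Let XnE n x : Xn n x + (wt t n)%:C *: iterT n (Xn n x) = x :=
  XnP hn (bX hM) (aX hM) (bV hM) (bV' hM) (aV hM) ht n x.
Let bA n : bop (fun x => (wt t n)%:C *: iterT n x) :=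
  bop_scale _ (bop_iterT (bX hM) (bV hM) (bV' hM) n).
Let pA n : positive ip (fun x => (wt t n)%:C *: iterT n x) :=
  positive_scale (ltW (wt_gt0 ht n)) (positive_iterT hn (aX hM) (aV hM) n).

Let Wxi : biorth ip (wX xi emb) xi.
Proof. by apply: biorth_sub; left. Qed.

Lemma Xn_xi_cauchy : exists l, cvs (fun n => Xn n xi) l.
Proof.
exact: (Xn_cauchy hn (bX hM) (aX hM) (XK hM) (bV hM) (bV' hM) (aV hM) (VK hM) (V'K hM)
  (iterV_orth hM) (X_iterV hM) (X_iterV' hM) (iterV_e hM) (iterV'_e hM) ht).
Qed.

Lemma Xn_xi_e n : ip (Xn n xi) (Z xi) = 0.
Proof.
apply: (Xn_e hn (bX hM) (aX hM) (XK hM) (bV hM) (bV' hM) (aV hM) (VK hM) (V'K hM)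
  (iterV_orth hM) (X_iterV hM) (X_iterV' hM) (iterV_e hM) (iterV'_e hM) ht) => //.
exact: xi_e hM.
Qed.

Lemma Xn_xi_tr n : ip (Xn n xi) xi = t%:C.
Proof.
rewrite (Xn_tr hn (bX hM) (aX hM) (XK hM) (bV hM) (bV' hM) (aV hM) (VK hM) (V'K hM)
  (iterV_orth hM) (X_iterV hM) (X_iterV' hM) (iterV_e hM) (iterV'_e hM) ht) //.
by rewrite (xi1 hM) mulr1.
Qed.

Lemma Xn_xi_nrm n : nrm (Xn n xi) ^+ 2 = t ^+ 2 + vv t n.
Proof.
have [_ h] := Xn_centred_prods hn (bX hM) (aX hM) (XK hM) (bV hM) (bV' hM) (aV hM)
  (VK hM) (V'K hM) (iterV_orth hM) (X_iterV hM) (X_iterV' hM) (iterV_e hM) (iterV'_e hM) ht n.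
apply: complexI; rewrite -(ip_nrm hn) h// (xi1 hM) mulr1.
by rewrite rmorphD rmorphXn.
Qed.

Lemma M_V : M V. Proof. exact: (M_comp hM (M_emb hM _ _) (M_emb hM _ _)). Qed.
Lemma M_V' : M V'. Proof. exact: (M_comp hM (M_emb hM _ _) (M_emb hM _ _)). Qed.

Lemma M_iterT n : M (iterT n).
Proof.
elim: n => [|n IH]; first exact: (M_id hM).
have mX : M X := M_emb hM _ _.
exact: (M_comp hM (M_sub hM M_V' M_V) (M_comp hM mX (M_comp hM IH (M_comp hM mX (M_sub hM M_V M_V'))))).
Qed.

Lemma M_Xn n : M (Xn n).
Proof. exact: (M_res hM (M_scale hM _ (M_iterT n)) (pA n)). Qed.

(** Conjugation by [Z] exchanges V = U Z and V' = Z U. As [Z] also anticommutes with [X], the two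
    signs cancel and [Z] commutes with T. *)
Lemma Z_dop x : Z (dop x) = - dop (Z x).
Proof.
rewrite /dop /V /V' (lopB (bZ hM)) (ZK hM) opprB (ZK hM).
by [].
Qed.

Lemma Z_dop' x : Z (dop' x) = - dop' (Z x).
Proof. by rewrite !dop'_dop (lopN (bZ hM)) Z_dop. Qed.

Lemma Z_X x : Z (X x) = - X (Z x).
Proof. by rewrite (XZ hM) opprK. Qed.

Lemma Z_iterT n x : Z (iterT n x) = iterT n (Z x).
Proof.
elim: n x => // n IH x /=.
have bD : bop dop' := bop_dop' (bV hM) (bV' hM).
rewrite Z_dop' Z_X IH Z_X Z_dop (lopN (bX hM)) opprK.
by rewrite (lopN bD) opprK.
Qed.

Lemma Z_Xn n x : Z (Xn n x) = Xn n (Z x).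
Proof.
apply: (res_comm hn (bA n) (pA n) (bZ hM)) => y.
by rewrite (lopZ (bZ hM)) Z_iterT.
Qed.

(** * Strong convergence *)

Lemma Xn_contract n x : nrm (Xn n x) <= nrm x.
Proof. exact: (nrm_res hn (bA n) (pA n)). Qed.

Lemma Xn_sa n : adjoint_of ip (Xn n) (Xn n).
Proof. exact: (res_sa hn (bA n) (pA n)). Qed.

(* The trace moves [T] away from X_m - X_n, reducing to convergence at [xi]. *)
Lemma cauchy_M T : M T -> forall e : R, 0 < e -> exists N, forall m n,
  (N <= m)%N -> (N <= n)%N -> nrm (Xn m (T xi) - Xn n (T xi)) < e.
Proof.
move=> mT e e0; have [T' mT' aT] := M_adj hM mT.
have [l hl] := Xn_xi_cauchy.
pose C := 2 * nrm (T (T' xi)) + 1.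
have C0 : 0 < C by rewrite ltr_wpDl// mulr_ge0// nrm_ge0.
have p : 0 < e ^+ 2 / C / 2 by rewrite !divr_gt0// exprn_gt0.
have [N hN] := hl _ p; exists N => m n Nm Nn.
have d : nrm (Xn m xi - Xn n xi) < e ^+ 2 / C.
  have := hN _ Nm; have := hN _ Nn; have := nrmD (Xn m xi - l) (l - Xn n xi).
  by rewrite addrA subrK (nrmBC l); lra.
pose D x := Xn m x - Xn n x.
have mD : M D := M_sub hM (M_Xn m) (M_Xn n).
have sD : adjoint_of ip D D by move=> x y; rewrite ipBl ipBr !Xn_sa.
rewrite -/(D (T xi)) -ltr_sqr ?nnegrE ?nrm_ge0 ?ltW//.
have -> : nrm (D (T xi)) ^+ 2 = rip ip (D (T (T' xi))) (D xi).
  rewrite (nrm2 hn) /rip; congr complex.Re.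
  by rewrite -sD -(adj_sym aT) (trC hM mT' (M_comp hM mD (M_comp hM mD mT))) sD.
apply: le_lt_trans (rip_CS' hn _ _) _.
have := nrmB (Xn m (T (T' xi))) (Xn n (T (T' xi))).
have := Xn_contract m (T (T' xi)); have := Xn_contract n (T (T' xi)).
rewrite -/(D _) => h1 h2 h3.
have h4 : nrm (D (T (T' xi))) <= C by rewrite /C; lra.
rewrite ltr_pdivlMr// in d.
rewrite -/(D xi) in d.
by apply: le_lt_trans d; have := nrm_ge0 (D xi) => ?; rewrite mulrC ler_wpM2l.
Qed.

Lemma Xn_cvs x : exists l, cvs (fun n => Xn n x) l.
Proof.
apply: cvs_complete => e e0.
have e3 : 0 < e / 3 by lra.
have [T mT hT] := cyclic hM x e3.
have [N hN] := cauchy_M mT e3; exists N => m n Nm Nn.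
have h k : nrm (Xn k x - Xn k (T xi)) < e / 3.
  by rewrite -(lopB (bXn k)); apply: le_lt_trans hT; exact: Xn_contract.
have := nrmD (Xn m x - Xn m (T xi)) (Xn m (T xi) - Xn n x).
rewrite addrA subrK => h1.
have := nrmD (Xn m (T xi) - Xn n (T xi)) (Xn n (T xi) - Xn n x).
rewrite addrA subrK => h2.
have := h m; have := h n; have := hN _ _ Nm Nn; rewrite (nrmBC (Xn n x)); lra.
Qed.

(** The strong limit of the X_n; by [Xn_cvs] the default 0 is never reached. *)
Definition Pinf x : H := xget 0 [set l | cvs (fun n => Xn n x) l].

Lemma PinfP x : cvs (fun n => Xn n x) (Pinf x).
Proof. by have [l hl] := Xn_cvs x; rewrite /Pinf; case: xgetP => // /(_ l). Qed.

Lemma bop_Pinf : bop Pinf.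
Proof.
split=> [a x y|].
  apply: cvs_unique (PinfP _) _; have := cvs_lin a (PinfP x) (PinfP y).
  move=> h e /h [N hN]; exists N => n /hN.
  by rewrite (bop_linear (bXn n)).
exists 1; split => // x; rewrite mul1r; apply/ler_addgt0Pr => e e0.
have [N hN] := PinfP x e0; have := hN N (leqnn _); have := Xn_contract N x.
have := nrmB (Xn N x) (Xn N x - Pinf x); rewrite subKr; lra.
Qed.

Lemma Pinf_comm S : bop S -> (forall n x, Xn n (S x) = S (Xn n x)) ->
  forall x, Pinf (S x) = S (Pinf x).
Proof.
move=> bS h x; apply: cvs_unique (PinfP _) _.
by move=> e /(bop_cvs bS (PinfP x)) [N hN]; exists N => n /hN; rewrite h.
Qed.

Lemma M_Pinf : M Pinf.
Proof.
apply/(memM hM); split=> [|S cS]; first exact: bop_Pinf.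
apply: Pinf_comm; first exact: comm_bop cS.
by move=> n x; have /(memM hM) [_] := M_Xn n; apply.
Qed.

Lemma Z_Pinf x : Z (Pinf x) = Pinf (Z x).
Proof. by rewrite (Pinf_comm (bZ hM))// => n y; rewrite Z_Xn. Qed.

Lemma Pinf_sa : adjoint_of ip Pinf Pinf.
Proof.
move=> x y; apply/eqP; rewrite -subr_eq0; apply/eqP/cab_eq0/eqP.
rewrite eq_le cab_ge0 andbT; apply/ler_addgt0Pr => e e0; rewrite add0r.
pose B := nrm x + nrm y + 1.
have B0 : 0 < B by rewrite ltr_wpDl// addr_ge0// nrm_ge0.
have [N1 h1] := PinfP x (divr_gt0 e0 B0); have [N2 h2] := PinfP y (divr_gt0 e0 B0).
have [n n1 n2] : exists2 n, (N1 <= n)%N & (N2 <= n)%N.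
  by exists (maxn N1 N2); rewrite ?leq_maxl ?leq_maxr.
have := h1 _ n1; have := h2 _ n2; rewrite !ltr_pdivlMr// /B => i2 i1.
have -> : ip (Pinf x) y - ip x (Pinf y) = ip x (Xn n y - Pinf y) - ip (Xn n x - Pinf x) y.
  by rewrite ipBr ipBl (Xn_sa n); ring.
have := cabD (ip x (Xn n y - Pinf y)) (- ip (Xn n x - Pinf x) y).
have := CS hn x (Xn n y - Pinf y); have := CS hn (Xn n x - Pinf x) y.
have -> : cab (- ip (Xn n x - Pinf x) y) = cab (ip (Xn n x - Pinf x) y) by rewrite /cab normrN.
have := nrm_ge0 x; have := nrm_ge0 y; have := nrm_ge0 (Xn n x - Pinf x).
have := nrm_ge0 (Xn n y - Pinf y); move=> p1 p2 p3 p4 p5 p6 p7; apply: le_trans p7 _.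
by move: p1 p2 p3 p4 p5 p6 i1 i2; move: (nrm _) (nrm _) (nrm _) (nrm _) => a b c d; nra.
Qed.

(** * Trace, idempotence and invariance of the limit *)

Lemma Pinf_tr : ip (Pinf xi) xi = t%:C.
Proof. exact: (cvs_ip hn (PinfP xi) Xn_xi_tr). Qed.

Lemma Pinf_e : ip (Pinf xi) (Z xi) = 0.
Proof. exact: (cvs_ip hn (PinfP xi) Xn_xi_e). Qed.

Lemma Pinf_pos x : nrm (Pinf x) ^+ 2 <= rip ip (Pinf x) x.
Proof.
rewrite -(rip_nrm hn).
apply: ler_cvg_to (cvs_rip hn (PinfP x) (PinfP x)) (cvs_rip hn (PinfP x) (cvs_cst x)) _.
apply: nearW => n; rewrite (rip_nrm hn).
exact: (rip_res_ge hn (bA n) (pA n)).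
Qed.

Lemma vv_cvg : vv t n @[n --> \oo] --> t * (1 - t).
Proof.
have [t0 t1] := andP ht.
apply: (@squeeze_cvgr _ _ _ _ (fun n => t * (1 - t) - (1 - t)^-1 * n.+1%:R^-1)
   (fun=> t * (1 - t))).
- apply: nearW => n; have /andP[_ ->] := vv_bound ht n; rewrite andbT.
  by rewrite lerBlDl -lerBlDr; exact: (vv_gap ht (leqnn n)).
- rewrite -[X in _ --> X]subr0; apply: cvgB; first exact: cvg_cst.
  rewrite -(mulr0 (1 - t)^-1); apply: cvgMr; exact: cvg_harmonic.
- exact: cvg_cst.
Qed.

Lemma Pinf_xi_nrm : nrm (Pinf xi) ^+ 2 = t.
Proof.
rewrite -(rip_nrm hn).
have := cvs_rip hn (PinfP xi) (PinfP xi) => h.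
have h2 : (fun n => t ^+ 2 + vv t n) @ \oo --> t ^+ 2 + t * (1 - t).
  by apply: cvgD; [exact: cvg_cst|exact: vv_cvg].
have E : (fun n => rip ip (Xn n xi) (Xn n xi)) = (fun n => t ^+ 2 + vv t n).
  by apply/funext => n; rewrite (rip_nrm hn) Xn_xi_nrm.
rewrite E in h; rewrite (cvg_unique _ h h2) //.
by ring.
Qed.

(** P - P^2 is positive, and its trace is t - (t^2 + t (1 - t)) = 0. Hence it kills [xi], and [xi]
    is separating. *)
Lemma PinfK x : Pinf (Pinf x) = Pinf x.
Proof.
pose B y := Pinf y - Pinf (Pinf y).
have mB : M B := M_sub hM M_Pinf (M_comp hM M_Pinf M_Pinf).
have PP z : rip ip (Pinf (Pinf z)) z = nrm (Pinf z) ^+ 2.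
  by rewrite -(rip_nrm hn) /rip Pinf_sa.
have pB : positive ip B.
  split; first by move=> y z; rewrite ipBl ipBr !Pinf_sa.
  by move=> y; have := Pinf_pos y; rewrite /B ripDl ripNl PP; lra.
have B0 : B xi = 0.
  apply: (positive_null hn (M_bop hM mB) pB).
  by rewrite /B ripDl ripNl PP Pinf_xi_nrm /rip Pinf_tr /= subrr.
by have /eqP := sep hM x mB B0; rewrite subr_eq0 => /eqP.
Qed.

(** Here 1 - X_n <= w_n T^*n T^n, and the value of the right side at T y is w_n / w_(n+1) = 4 t / (1
    + t) times <x - y, y>, by the resolvent equation for y = X_(n+1) x. In the limit <x, P x> - |P
    x|^2 = 0 remains. *)
Lemma Xn_invariant n x y eta : y = Xn n.+1 x -> eta = X (dop y) ->
  rip ip (eta - Xn n eta) eta <= 4 * t / (1 + t) * (rip ip x y - nrm y ^+ 2).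
Proof.
have [t0 t1] := andP ht.
move=> y_def eta_def; pose A z := (wt t n)%:C *: iterT n z.
have [sA pA'] : positive ip A := pA n.
set u := Xn n eta; have uE : u + A u = eta := XnE n eta.
have i1 : rip ip (eta - u) eta <= rip ip (A eta) eta.
  have -> : eta - u = A u by rewrite -uE addrC addKr.
  rewrite -{1}uE -{1 2}uE [A (u + A u)](lopD (bA n)) -/(A _) -/(A _).
  rewrite !ripDl !(ripC ip _ (u + A u)) !ripDl.
  have := pA' (A u); rewrite (ripC ip (A (A u))).
  have -> : rip ip u (A (A u)) = nrm (A u) ^+ 2 by rewrite /rip -sA -/(rip ip _ _) (rip_nrm hn).
  rewrite (rip_nrm hn) (ripC ip u); have := sqr_ge0 (nrm (A u)); lra.
apply: (le_trans i1).
have yE : y + (wt t n.+1)%:C *: iterT n.+1 y = x by rewrite y_def; exact: (XnE n.+1 x).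
have -> : rip ip x y - nrm y ^+ 2 = wt t n.+1 * rip ip (iterT n.+1 y) y.
  by rewrite -{1}yE ripDl (rip_nrm hn) ripZl addrC addKr.
have -> : rip ip (iterT n.+1 y) y = rip ip (iterT n eta) eta.
  have aD := adj_sym (adj_dop (aV hM)).
  by rewrite eta_def /rip /= aD (aX hM).
rewrite /A ripZl mulrA le_eqVlt; apply/orP; left; apply/eqP; congr (_ * _).
rewrite /wt exprS; field; rewrite !gt_eqF//; lra.
Qed.

Lemma Pinf_T x : Pinf (X (dop (Pinf x))) = X (dop (Pinf x)).
Proof.
have bT : bop (fun y => X (dop y)) := bop_comp (bX hM) (bop_dop (bV hM) (bV' hM)).
set eta := X _.
(* The index n.+1 leaves room for T, which uses up one power before X_n is applied. *)
have ce : cvs (fun n => X (dop (Xn n.+1 x))) eta.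
  exact: (bop_cvs bT (cvs_shift (PinfP x))).
have cP : cvs (fun n => Xn n (X (dop (Xn n.+1 x)))) (Pinf eta).
  move=> e e0; have e2 : 0 < e / 2 by lra.
  have [N1 h1] := ce _ e2; have [N2 h2] := PinfP eta e2.
  exists (maxn N1 N2) => n; rewrite geq_max => /andP[/h1 i1 /h2 i2].
  have := nrmD (Xn n (X (dop (Xn n.+1 x))) - Xn n eta) (Xn n eta - Pinf eta).
  rewrite addrA subrK -(lopB (bXn n)); have := Xn_contract n (X (dop (Xn n.+1 x)) - eta); lra.
have c1 := cvs_rip hn (cvs_lin (-1) cP ce) ce.
have c2 : (fun n => 4 * t / (1 + t) * (rip ip x (Xn n.+1 x) - rip ip (Xn n.+1 x) (Xn n.+1 x))) @ \oo -->
   4 * t / (1 + t) * (rip ip x (Pinf x) - rip ip (Pinf x) (Pinf x)).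
  have cs := cvs_shift (PinfP x).
  by apply: cvgMr; apply: cvgB; apply: (cvs_rip hn) => //; exact: cvs_cst.
have : rip ip (-1 *: Pinf eta + eta) eta <=
   4 * t / (1 + t) * (rip ip x (Pinf x) - rip ip (Pinf x) (Pinf x)).
  apply: ler_cvg_to c1 c2 _; apply: nearW => n.
  by rewrite scaleN1r addrC (rip_nrm hn); exact: Xn_invariant.
have PP z : rip ip z (Pinf z) = nrm (Pinf z) ^+ 2.
  by rewrite -(rip_nrm hn) /rip Pinf_sa PinfK.
rewrite PP (rip_nrm hn) subrr mulr0 scaleN1r addrC ripDl ripNl (ripC ip (Pinf eta)) PP => h.
have : nrm (eta - Pinf eta) ^+ 2 <= 0.
  rewrite -(rip_nrm hn) ripDl ripNl !(ripC ip _ (eta - _)) !ripDl !ripNl.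
  rewrite (ripC ip (Pinf eta) eta) PP !(rip_nrm hn); rewrite (rip_nrm hn) in h; lra.
rewrite le_eqVlt ltNge sqr_ge0 orbF sqrf_eq0 => /eqP /nrm_eq0 /eqP.
by rewrite subr_eq0 => /eqP.
Qed.

End Limit.

(** * Kernels and eigenvectors *)

Section Kernels.
Context {R : realType} {H : completeNormedModType R[i]}.
Variable ip : {dot H for Num.conj}.
Hypothesis hn : hilbert_norm ip.
Implicit Types (x y z : H) (A B P : H -> H) (K : set H).

Definition ker B : set H := [set x | B x = 0].

Lemma ker_csub B : bop B -> csub (ker B).
Proof.
move=> bB; split; first exact: lop0.
  by move=> c x y; rewrite /ker /= => hx hy; rewrite (bop_linear bB) hx hy scaler0 addr0.
move=> u l hu ul; apply: cvs_unique (bop_cvs bB ul) _.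
by move=> e e0; exists 0%N => n _; rewrite (hu n : B _ = 0) subrr nrm0.
Qed.

(** The resolvents fix ker A and have norm at most 2 |z| / (n + 1) at A z. Being contractions, they
    tend to 0 on the closure of the range of A, the orthogonal complement of ker A. *)
Lemma res_ker_cvs A P x : bop A -> positive ip A -> orth_proj ip (ker A) P ->
  cvs (fun n => res (fun y => (n.+1%:R)%:C *: A y) x) (P x).
Proof.
move=> bA pA hP; have [bP kP oP] := hP.
have bnA n : bop (fun y => (n.+1%:R : R)%:C *: A y) by apply: bop_scale.
have pnA n : positive ip (fun y => (n.+1%:R : R)%:C *: A y) by apply: positive_scale.
(* The closure of the range of [A]. *)
pose K : set H := [set y | forall e : R, 0 < e -> exists z, nrm (y - A z) < e].
have cK : csub K.
  split.
  - by move=> e e0; exists 0; rewrite (lop0 bA) subrr nrm0.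
  - move=> c y z hy hz e e0.
    have c1 : 0 < cab c + 1 by rewrite ltr_wpDl// cab_ge0.
    have e2 : 0 < e / 2 by lra.
    have [y' hy'] := hy _ (divr_gt0 e2 c1); have [z' hz'] := hz _ e2.
    exists (c *: y' + z'); rewrite (bop_linear bA) opprD addrACA -scalerBr.
    rewrite ltr_pdivlMr// in hy'.
    apply: le_lt_trans (nrmD _ _) _; rewrite nrmZ.
    have := nrm_ge0 (y - A y'); have := cab_ge0 c; nra.
  - move=> u l hu ul e e0; have e2 : 0 < e / 2 by lra.
    have [N hN] := ul _ e2; have [z hz] := hu N _ e2; exists z.
    have := nrmD (l - u N) (u N - A z); rewrite addrA subrK (nrmBC l).
    have := hN N (leqnn _); lra.
set eta := x - P x.
have Keta : K eta.
  have [y Ky oy] := csub_decomp hn eta cK.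
  have ran z : K (A z) by move=> e e0; exists z; rewrite subrr nrm0.
  have k0 : A (eta - y) = 0.
    by apply: (vec_eq hn) => z; rewrite (pA.1) oy// ip0l.
  have oyk z : A z = 0 -> ip y z = 0.
    move=> Az; apply: (@cab_eq0 R); apply/eqP; rewrite eq_le cab_ge0 andbT.
    apply/ler_addgt0Pr => e e0; rewrite add0r.
    have z1 : 0 < nrm z + 1 by rewrite ltr_wpDl// nrm_ge0.
    have [w hw] := Ky _ (divr_gt0 e0 z1); rewrite ltr_pdivlMr// in hw.
    have := CS hn (y - A w) z; rewrite ipBl (pA.1) Az ip0r subr0.
    have := nrm_ge0 (y - A w); nra.
  have : eta - y = 0.
    apply: (ip_eq0 hn); rewrite {1}ipBl oyk// subr0.
    by rewrite /eta oP.
  by move=> /eqP; rewrite subr_eq0 => /eqP ->.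
move=> e e0; have e2 : 0 < e / 2 by lra.
have [z hz] := Keta _ e2.
have [N hN] : exists N, 2 * nrm z * N.+1%:R^-1 < e / 2.
  have p : 0 < e / 2 / (2 * nrm z + 1) by rewrite divr_gt0// ltr_wpDl// mulr_ge0// nrm_ge0.
  have [N hN] := ltr_add_invr p; exists N.
  rewrite add0r ltr_pdivlMr ?ltr_wpDl ?mulr_ge0 ?nrm_ge0// in hN.
  apply: le_lt_trans hN; rewrite mulrC ler_wpM2l// lerDl.
  by [].
exists N => n Nn; set Xn := res _.
have bX : bop Xn := bop_res hn (bnA n) (pnA n).
have XP : Xn (P x) = P x.
  by apply: (res_unique hn (bnA n) (pnA n)); rewrite (kP x : A _ = 0) scaler0 addr0.
have -> : Xn x - P x = Xn (eta - A z) + Xn (A z).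
  by rewrite -(lopD bX) subrK /eta (lopB bX) XP.
have XA : (n.+1%:R)%:C *: Xn (A z) = z - Xn z.
  have : Xn (z + (n.+1%:R)%:C *: A z) = z := resK hn (bnA n) (pnA n) z.
  rewrite (lopD bX) (lopZ bX) => E.
  by apply/esym/eqP; rewrite subr_eq addrC E.
have h1 : nrm (Xn (A z)) <= 2 * nrm z * N.+1%:R^-1.
  have i : N.+1%:R <= n.+1%:R :> R by rewrite ler_nat.
  rewrite ler_pdivlMr//.
  have : nrm (z - Xn z) <= 2 * nrm z.
    apply: le_trans (nrmB _ _) _; rewrite mulr_natl mulr2n lerD2l.
    exact: (nrm_res hn (bnA n) (pnA n)).
  rewrite -XA nrmZr// => h; apply: le_trans h; rewrite mulrC ler_wpM2r ?nrm_ge0//.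
have h2 : nrm (Xn (eta - A z)) <= nrm (eta - A z) := nrm_res hn (bnA n) (pnA n) (eta - A z).
apply: le_lt_trans (nrmD _ _) _; rewrite [e]splitr.
by apply: ltrD; [exact: le_lt_trans h2 hz|exact: le_lt_trans h1 hN].
Qed.

Lemma positive_gram B B' : adjoint_of ip B B' -> positive ip (fun x => B' (B x)).
Proof. by move=> aB; apply: (positive_conj aB (positive_id hn)). Qed.

Lemma ker_gram B B' : adjoint_of ip B B' -> bop B' -> ker (fun x => B' (B x)) = ker B.
Proof.
move=> aB bB'; apply/seteqP; split=> x; rewrite /ker /= => h.
  by apply: (ip_eq0 hn); rewrite aB h ip0r.
by rewrite h (lop0 bB').
Qed.

End Kernels.

Section KernelTrace.
Context {R : realType} {H : completeNormedModType R[i]}.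
Variables (ip : {dot H for Num.conj}) (M : set (H -> H)).
Variables (tau : (H -> H) -> R[i]) (xi : H) (emb : bool -> 'M[R[i]]_2 -> H -> H).
Hypothesis hM : free_product_M2 ip M tau xi emb.
Implicit Types (x y z : H) (T A B P : H -> H) (K : set H).

Let hn : hilbert_norm ip := fp_hilbert hM.

(** From (1 + k B^* B)^-1 = 1 - k B^* (1 + k B B^* )^-1 B, where the trace carries the leading B^*
    to the right end. *)
Lemma tr_res_gram B B' (k : R) : M B -> adjoint_of ip B B' -> 0 <= k ->
  ip (res (fun y => k%:C *: B' (B y)) xi) xi = ip (res (fun y => k%:C *: B (B' y)) xi) xi.
Proof.
move=> mB aB k0; have mB' := M_adj_of hM mB aB.
have bB := M_bop hM mB; have bB' := M_bop hM mB'.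
have p1 := positive_scale k0 (positive_gram hn aB).
have p2 := positive_scale k0 (positive_gram hn (adj_sym aB)).
have m1 := M_scale hM k%:C (M_comp hM mB' mB); have m2 := M_scale hM k%:C (M_comp hM mB mB').
have b1 := M_bop hM m1; have b2 := M_bop hM m2.
set X := res _; set X' := res _.
have bX' : bop X' := bop_res hn b2 p2.
have mX' : M X' := M_res hM m2 p2.
have X'E y : k%:C *: X' (B (B' y)) = y - X' y.
  have : X' (y + k%:C *: B (B' y)) = y := resK hn b2 p2 y.
  rewrite (lopD bX') (lopZ bX') => E.
  by apply/esym/eqP; rewrite subr_eq addrC E.
have XE y : X y = y - k%:C *: B' (X' (B y)).
  apply: (res_unique hn b1 p1).
  have E : X' (B y) + k%:C *: B (B' (X' (B y))) = B y := resP hn b2 p2 (B y).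
  have E2 : B' (B y) = B' (X' (B y)) + k%:C *: B' (B (B' (X' (B y)))).
    by rewrite -{1}E (lopD bB') (lopZ bB').
  by rewrite (lopB bB) (lopZ bB) (lopB bB') (lopZ bB') E2 addrK subrK.
rewrite XE ipBl ipZl (trC hM mB' (M_comp hM mX' mB)) -ipZl X'E ipBl.
by rewrite opprB addrC subrK.
Qed.

(** Letting k tend to infinity in [tr_res_gram] gives both kernel projections, without a polar
    decomposition of [B]. *)
Lemma tr_ker B B' P P' : M B -> adjoint_of ip B B' ->
  orth_proj ip (ker B) P -> orth_proj ip (ker B') P' -> ip (P xi) xi = ip (P' xi) xi.
Proof.
move=> mB aB; have mB' := M_adj_of hM mB aB.
have bB := M_bop hM mB; have bB' := M_bop hM mB'.
rewrite -(ker_gram hn aB bB') -(ker_gram hn (adj_sym aB) bB) => hP hP'.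
have c1 := res_ker_cvs hn xi (bop_comp bB' bB) (positive_gram hn aB) hP.
have c2 := res_ker_cvs hn xi (bop_comp bB bB') (positive_gram hn (adj_sym aB)) hP'.
have := cvs_ip hn (cvs_lin (-1) c2 c1) (y := xi) (c := 0).
rewrite ipDl ipZl => h; apply/eqP; rewrite -subr_eq0 addrC -mulN1r h// => n.
rewrite ipDl ipZl (tr_res_gram mB aB)// mulN1r addNr.
by [].
Qed.

Local Notation V := (V emb).
Local Notation V' := (V' emb).

(* The vectors V^k xi are orthonormal, while the projection [Q] onto the
   eigenspace satisfies |<Q xi, V^k xi>| = tr Q for all k. *)
Lemma no_eigenvector (b : bool) y : V y = (-1) ^+ b *: y -> y = 0.
Proof.
move=> Vy; set s : R[i] := (-1) ^+ b.
have ss : s * s = 1 by rewrite -expr2 sqrr_sign.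
have sc : Num.conj s = s by rewrite rmorph_sign.
have bV := bV hM; have bV' := bV' hM.
pose B x := V x - s *: x.
have mB : M B := M_sub hM (M_V hM) (M_scale hM s (M_id hM)).
have [Q hQ] := orth_proj_exists hn (ker_csub (M_bop hM mB)).
have mQ : M Q.
  apply: (M_proj hM (ker_csub (M_bop hM mB)) _ hQ) => S x cS Bx.
  have /(memM hM) [_ /(_ _ cS)] := mB; rewrite /ker /= => ->.
  by rewrite (Bx : B x = 0) (lop0 (comm_bop cS)).
have [bQ kQ oQ] := hQ.
have VQ x : V (Q x) = s *: Q x by apply/eqP; rewrite -subr_eq0; apply/eqP; exact: kQ.
have V'Q x : V' (Q x) = s *: Q x.
  by rewrite -{2}(VK hM (Q x)) VQ (lopZ bV') scalerA ss scale1r.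
(* [v n] is the sum of s^k V^k xi over k < n, of squared norm n, while <Q xi, v n> = n q.
   Cauchy-Schwarz yields (n q)^2 <= q n for every n, hence q = 0. *)
pose v := fix v n := if n is n'.+1 then xi + s *: V (v n') else 0.
have vS n : v n.+1 = xi + s *: V (v n) by [].
pose G := [set x | exists k, x = iter k V xi].
have cG := biorth_csub hn G.
have Gv n : biorth ip G (v n).
  elim: n => [|n IH]; first by case: cG.
  apply: (csubD cG); first by apply: biorth_sub; exists 0%N.
  apply: (csubZ _ cG); apply: (biorth_map (aV hM) _ IH) => _ [k ->].
  by apply: biorth_sub; exists k.+1.
have wxi : wX xi emb xi by left.
have oxi n : ip (V (v n)) xi = 0.
  rewrite (aV hM); apply: Gv => _ [k ->]; rewrite -(aV hM) -iterS.
  exact: (iterV_orth hM).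
have nv n : ip (v n) (v n) = n%:R.
  elim: n => [|n IH]; first by rewrite ip0l.
  rewrite vS ipDl !ipDr !ipZl !ipZr oxi (ipC ip xi (V _)) oxi rmorph0 !mulr0 addr0 add0r.
  by rewrite (xi1 hM) (ip_isom (aV hM) (VK hM)) IH mulrA sc ss mul1r -natr1 addrC.
set q := nrm (Q xi) ^+ 2.
have qE : ip (Q xi) xi = q%:C.
  by rewrite /q -(ip_nrm hn) -(orth_proj_sa hQ) (orth_proj_id hn hQ (kQ xi)).
have iv n : ip (Q xi) (v n) = (n%:R * q)%:C.
  elim: n => [|n IH]; first by rewrite ip0r mul0r.
  rewrite vS ipDr ipZr -(adj_sym (aV hM)) V'Q ipZl mulrA sc ss mul1r IH qE -rmorphD.
  by rewrite -natr1 mulrDl mul1r addrC.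
have q0 : 0 <= q := sqr_ge0 _.
have hq n : (n%:R * q) ^+ 2 <= q * n%:R.
  have nn : nrm (v n) ^+ 2 = n%:R.
    by apply: complexI; rewrite -(ip_nrm hn) nv rmorph_nat.
  have := CS hn (Q xi) (v n); rewrite iv cab_rc.
  have nq0 : 0 <= n%:R * q := mulr_ge0 (ler0n _ _) q0.
  rewrite (ger0_norm nq0) => h.
  apply: (@le_trans _ _ ((nrm (Q xi) * nrm (v n)) ^+ 2)); last by rewrite exprMn nn.
  by rewrite ler_sqr ?nnegrE// mulr_ge0 ?nrm_ge0.
have qz : q = 0.
  apply/eqP; rewrite eq_le q0 andbT leNgt; apply/negP => qp.
  have [N hN] := ltr_add_invr qp; rewrite add0r in hN.
  have N0 : 0 < N.+1%:R :> R by [].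
  have h := hq N.+1.
  have : 1 < q * N.+1%:R by rewrite -ltr_pdivrMr// mul1r.
  rewrite mulrC => h1; have c0 := lt_trans ltr01 h1.
  by move: h; rewrite [leRHS]mulrC expr2 -[leRHS]mul1r ler_pM2r// leNgt h1.
have Q0 : Q xi = 0 by apply: nrm_eq0; apply/eqP; rewrite -sqrf_eq0 -/q qz.
have : Q y = y by apply: (orth_proj_id hn hQ); rewrite /ker /= /B Vy subrr.
by rewrite (sep hM y mQ Q0).
Qed.

End KernelTrace.

(** * The invariant projection *)

Section Final.
Context {R : realType} {H : completeNormedModType R[i]}.
Variables (ip : {dot H for Num.conj}) (M : set (H -> H)).
Variables (tau : (H -> H) -> R[i]) (xi : H) (emb : bool -> 'M[R[i]]_2 -> H -> H).
Hypothesis hM : free_product_M2 ip M tau xi emb.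
Implicit Types (x y z : H) (T A B P : H -> H) (K : set H).
Variable t : R.
Hypothesis ht : 0 < t < 1.

Let hn : hilbert_norm ip := fp_hilbert hM.
Local Notation U := (U emb).
Local Notation Z := (Z emb).
Local Notation X := (X emb).
Local Notation V := (V emb).
Local Notation V' := (V' emb).
Local Notation dop := (dop V V').
Local Notation Pinf := (Pinf emb t).

Definition munitE (i : 'I_2) := emb false (delta_mx i i).
Definition munitF (i j : 'I_2) := emb true (delta_mx i j).

Lemma M_E i : M (munitE i). Proof. exact: M_emb hM _ _. Qed.
Lemma M_F i j : M (munitF i j). Proof. exact: M_emb hM _ _. Qed.
Lemma bE i : bop (munitE i). Proof. exact: emb_bop hM _ _. Qed.
Lemma bF i j : bop (munitF i j). Proof. exact: emb_bop hM _ _. Qed.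

Lemma F_F i j k l x : munitF i j (munitF k l x) = if j == k then munitF i l x else 0.
Proof.
rewrite /munitF (embM hM) mul_delta_mx_cond; case: eqP => _; first by rewrite mulr1n.
by rewrite mulr0n -(scale0r 0) (embZ hM) scale0r.
Qed.
Lemma E_E i j x : munitE i (munitE j x) = if i == j then munitE i x else 0.
Proof.
rewrite /munitE (embM hM) mul_delta_mx_cond; case: eqP => [->|_]; first by rewrite mulr1n.
by rewrite mulr0n -(scale0r 0) (embZ hM) scale0r.
Qed.

Lemma adj_delta i j : map_mx Num.conj (delta_mx i j : 'M[R[i]]_2)^T = delta_mx j i.
Proof. by rewrite trmx_delta; apply/matrixP => k l; rewrite !mxE rmorph_nat. Qed.

Lemma E_adj i : adjoint_of ip (munitE i) (munitE i).
Proof. by have := emb_adj hM false (delta_mx i i); rewrite adj_delta. Qed.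
Lemma F_adj i j : adjoint_of ip (munitF i j) (munitF j i).
Proof. by have := emb_adj hM true (delta_mx i j); rewrite adj_delta. Qed.

Lemma delta_sum : (delta_mx 0 0 + delta_mx 1 1 : 'M[R[i]]_2) = 1%:M.
Proof. by apply: mx2P; rewrite !mxE /= ?addr0 ?add0r. Qed.

Lemma E_sum x : munitE 0 x + munitE 1 x = x.
Proof. by rewrite /munitE -(embD hM) delta_sum (emb1 hM). Qed.
Lemma F_sum x : munitF 0 0 x + munitF 1 1 x = x.
Proof. by rewrite /munitF -(embD hM) delta_sum (emb1 hM). Qed.
Lemma UE x : U x = munitE 0 x - munitE 1 x.
Proof. by rewrite /U /mZ (embD hM) (embN hM). Qed.
Lemma ZE x : Z x = munitF 0 0 x - munitF 1 1 x.
Proof. by rewrite /Z /mZ (embD hM) (embN hM). Qed.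
Lemma XE x : X x = munitF 0 1 x + munitF 1 0 x.
Proof. by rewrite /X /mX (embD hM). Qed.

Lemma F00_half x : 2 *: munitF 0 0 x = x + Z x.
Proof.
rewrite ZE -{2}(F_sum x); apply: (vec_eq hn) => z.
by rewrite !(ipDl, ipNl, ipZl); ring.
Qed.

Lemma F00_Pinf x : munitF 0 0 (Pinf x) = Pinf (munitF 0 0 x).
Proof.
have bP := bop_Pinf hM ht.
have e (y y' : H) : 2 *: y = 2 *: y' -> y = y'.
  by move=> h; apply: (scalerI _ h); rewrite pnatr_eq0.
by apply: e; rewrite -(lopZ bP) !F00_half (lopD bP) (Z_Pinf hM ht).
Qed.

(* [defect x = 0] means that F_01 x lies in the range of [Pinf]; the invariant
   subspace consists of the x with [defect (E_ii x) = 0] for i = 0, 1. *)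
Definition defect x := munitF 1 0 (munitF 0 1 x - Pinf (munitF 0 1 x)).

Lemma M_N : M defect.
Proof.
exact: (M_comp hM (M_F 1 0) (M_sub hM (M_F 0 1) (M_comp hM (M_Pinf hM ht) (M_F 0 1)))).
Qed.
Let bN := M_bop hM M_N.

Lemma N_adj : adjoint_of ip defect defect.
Proof.
by move=> x y; rewrite /defect (F_adj 1 0) -(F_adj 0 1 x) ipBl ipBr (Pinf_sa hM ht).
Qed.

Lemma F01_N x : munitF 0 1 (defect x) = munitF 0 1 x - Pinf (munitF 0 1 x).
Proof. by rewrite /defect F_F /= (lopB (bF 0 0)) F00_Pinf F_F. Qed.

Lemma N_idem x : defect (defect x) = defect x.
Proof.
rewrite {1}/defect F01_N; congr (munitF 1 0 _).
by rewrite (lopB (bop_Pinf hM ht)) (PinfK hM ht) subrr subr0.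
Qed.

Lemma F00_N x : munitF 0 0 (defect x) = 0.
Proof. by rewrite /defect F_F. Qed.

Lemma N_eq0 x : defect x = 0 <-> Pinf (munitF 0 1 x) = munitF 0 1 x.
Proof.
split=> [h|h]; last by rewrite /defect h subrr (lop0 (bF _ _)).
by have := F01_N x; rewrite h (lop0 (bF _ _)) => /esym /eqP; rewrite subr_eq0 => /eqP.
Qed.

(** The trace turns [defect] into (1 - P) F_11 with F_11 = (1 + Z) / 2, and both Z and P Z have
    trace 0. *)
Lemma N_tr : ip (defect xi) xi = (1 - t%:C) / 2.
Proof.
have mP := M_Pinf hM ht; have bP := bop_Pinf hM ht.
pose G x := munitF 0 1 x - Pinf (munitF 0 1 x).
have mG : M G := M_sub hM (M_F 0 1) (M_comp hM mP (M_F 0 1)).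
rewrite /defect (trC hM (M_F 1 0) mG) /G !F_F /=.
have : 2 * ip (munitF 0 0 xi - Pinf (munitF 0 0 xi)) xi = 1 - t%:C.
  rewrite -ipZl scalerBr -(lopZ bP) F00_half (lopD bP) !(ipDl, ipNl, ipBl).
  rewrite (Pinf_sa hM ht (Z xi)) (ipC ip (Z xi) (Pinf xi)) (Pinf_e hM ht) rmorph0.
  rewrite (ipC ip (Z xi)) (xi_e hM) rmorph0 (Pinf_tr hM ht) (xi1 hM); ring.
by move=> <-; rewrite mulrAC mulfV ?mul1r// pnatr_eq0.
Qed.

(** On the range of [defect], which lies in that of F_22, Z is -1. If one of E_11, E_22 kills w,
    then U w is w or -w, and w is an eigenvector of V. *)
Lemma E_N_ker i y : munitE i (defect y) = 0 -> defect y = 0.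
Proof.
set w := defect y => h.
have Zw : Z w = - w by rewrite ZE -{3}(F_sum w) F00_N !add0r.
apply: (@no_eigenvector _ _ _ _ _ _ _ hM (i == 1)).
rewrite /V Zw (lopN (bU hM)) UE.
have := E_sum w; move: h; have [->|->] : i = 0 \/ i = 1.
  by case: i => -[|[|//]] h; [left|right]; apply/val_inj.
  by move=> -> /= e; rewrite sub0r opprK expr0 scale1r -{2}e add0r.
by move=> -> /= e; rewrite subr0 expr1 scaleN1r -{2}e addr0.
Qed.

(** By [tr_ker] one may pass to the adjoint E_ii [defect], whose kernel is that of the projection
    [defect] alone; its trace is 1 - (1 - t) / 2. *)
Lemma ker_N_E_proj i : exists L, [/\ M L, orth_proj ip (ker (fun x => defect (munitE i x))) L
  & ip (L xi) xi = (1 + t%:C) / 2].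
Proof.
pose B x := defect (munitE i x); have mB : M B := M_comp hM M_N (M_E i).
have cK := ker_csub (M_bop hM mB).
have [L hL] := orth_proj_exists hn cK; exists L; split => //.
  apply: (M_proj hM cK _ hL) => S x cS Bx.
  have /(memM hM) [_ /(_ _ cS)] := mB; rewrite /ker /= => ->.
  by rewrite (Bx : B x = 0) (lop0 (comm_bop cS)).
have aB : adjoint_of ip B (fun x => munitE i (defect x)) by move=> x y; rewrite N_adj E_adj.
have hL' : orth_proj ip (ker (fun x => munitE i (defect x))) (fun x => x - defect x).
  split; first exact: bop_sub (bop_id) bN.
    by move=> x; rewrite /ker /= (lopB bN) N_idem subrr (lop0 (bE i)).
  by move=> x z /E_N_ker Nz; rewrite subKr N_adj Nz ip0r.
rewrite (tr_ker hM mB aB hL hL') ipBl (xi1 hM) N_tr.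
by field.
Qed.

Lemma invariant_projection : exists P, [/\ M P, is_projection ip P, ip (P xi) xi = t%:C
  & forall T, T = munitE 0 \/ T = munitF 0 1 \/ commutant M T ->
      forall x, P x = x -> P (T x) = T x].
Proof.
have [L0 [mL0 hL0 tL0]] := ker_N_E_proj 0.
have [L1 [mL1 hL1 tL1]] := ker_N_E_proj 1.
have [bL0 kL0 oL0] := hL0; have [bL1 kL1 oL1] := hL1.
(* The complements of [L0] and [L1] lie under the orthogonal projections E_11 and E_22, so this is
   the projection onto the intersection of the two ranges, of trace 2 (1 + t) / 2 - 1 = t. *)
pose P x := L0 x + L1 x - x.
have mP : M P := M_sub hM (M_add hM mL0 mL1) (M_id hM).
have E_L0 x : munitE 1 (L0 x) = munitE 1 x.
  apply: (vec_eq hn) => z; rewrite E_adj (orth_proj_sa hL0) (orth_proj_id hn hL0) ?E_adj//.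
  by rewrite /ker /= E_E (lop0 bN).
have E_L1 x : munitE 0 (L1 x) = munitE 0 x.
  apply: (vec_eq hn) => z; rewrite E_adj (orth_proj_sa hL1) (orth_proj_id hn hL1) ?E_adj//.
  by rewrite /ker /= E_E (lop0 bN).
pose Q : set H := [set x | defect (munitE 0 x) = 0 /\ defect (munitE 1 x) = 0].
have hP : orth_proj ip Q P.
  split; first exact: (M_bop hM mP).
    move=> x; rewrite /Q /P /=; split.
      rewrite (lopB (bE 0)) (lopD (bE 0)) E_L1 addrK.
      exact: kL0.
    rewrite (lopB (bE 1)) (lopD (bE 1)) E_L0 addrC addKr.
    exact: kL1.
  move=> x z [Qz0 Qz1].
  have -> : x - P x = (x - L0 x) + (x - L1 x).
    by rewrite /P; apply: (vec_eq hn) => w; rewrite !(ipDl, ipNl); ring.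
  by rewrite ipDl oL0// oL1// addr0.
have QP x : P x = x <-> Q x.
  by split=> [<-|/(orth_proj_id hn hP)//]; have [_ kP _] := hP.
exists P; split => //; first exact: (orth_proj_is_projection hn hP).
  by rewrite /P ipBl ipDl tL0 tL1 (xi1 hM); field.
have QN x : Q x -> defect x = 0.
  by case=> h0 h1; rewrite -(E_sum x) (lopD bN) h0 h1 addr0.
move=> T hT x /QP Qx; apply/QP; have [Qx0 Qx1] := Qx.
case: hT => [->|[->|cT]].
- by rewrite /Q /= !E_E /=; split => //; exact: (lop0 bN).
(* As [w] lies in the ranges of F_11 and of P, T w = 2 F_12 U w is again in the range of P, that is,
   [defect (U w) = 0]. Also [defect w = 0] because F_12 w = 0, and E_11 w and E_22 w are (w + U w) /
   2 and (w - U w) / 2. *)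
- set w := munitF 0 1 x.
  have Pw : Pinf w = w by apply/N_eq0; exact: QN.
  have Nw : defect w = 0.
    by apply/N_eq0; rewrite /w F_F /= (lop0 (bop_Pinf hM ht)).
  have Zw : Z w = w by rewrite ZE /w !F_F /= subr0.
  have Tw : X (dop w) = 2 *: munitF 0 1 (U w).
    rewrite /dop /V /V' Zw XE !(lopB (bF _ _)) ZE !(lopB (bF _ _)) !F_F /=.
    apply: (vec_eq hn) => z; rewrite !(ipDl, ipNl, ipZl) ip0l; ring.
  have NUw : defect (U w) = 0.
    apply/N_eq0.
    have := Pinf_T hM ht w; rewrite Pw Tw (lopZ (bop_Pinf hM ht)) => h.
    by apply: (scalerI _ h); rewrite pnatr_eq0.
  have two (y : H) : 2 *: y = 0 -> y = 0.
    by move=> /eqP; rewrite scaler_eq0 pnatr_eq0 => /eqP.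
  split; apply: two; rewrite -(lopZ bN).
    have -> : 2 *: munitE 0 w = w + U w.
      rewrite UE -{2}(E_sum w); apply: (vec_eq hn) => z.
      by rewrite !(ipDl, ipNl, ipZl); ring.
    by rewrite (lopD bN) Nw NUw addr0.
  have -> : 2 *: munitE 1 w = w - U w.
    rewrite UE -{2}(E_sum w); apply: (vec_eq hn) => z.
    by rewrite !(ipDl, ipNl, ipZl); ring.
  by rewrite (lopB bN) Nw NUw subr0.
- have [/bopP bT hT] := cT.
  have h S y : M S -> S (T y) = T (S y).
    by move=> mS; have /(congr1 (fun f => f y)) := hT S mS.
  by split; rewrite !(h _ _ (M_E _)) (h _ _ M_N) ?Qx0 ?Qx1 (lop0 bT).
Qed.

End Final.

(** * Passage to the generated algebra *)

Lemma generated_algebra_preserves (R : realType) (H : completeNormedModType R[i])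
    (A : set (H -> H)) (K : set H) :
  A `<=` bounded_op -> K 0 -> (forall (c : R[i]) x y, K x -> K y -> K (c *: x + y)) ->
  (forall T x, A T -> K x -> K (T x)) ->
  forall T, generated_algebra A T -> bounded_op T /\ forall x, K x -> K (T x).
Proof.
move=> bA K0 Kl hA T.
move=> /(_ [set S | bounded_op S /\ forall x, K x -> K (S x)]); apply.
split; last by move=> S AS; split; [exact: bA|move=> x; exact: hA].
split.
- by move=> S [].
- by split=> [|x Kx] //; apply/bopP; split=> [c x y|]; rewrite ?scaler0 ?addr0//;
    exists 0; split => // x; rewrite nrm0 mul0r.
- move=> S S' [/bopP bS hS] [/bopP bS' hS']; split=> [|x Kx].
    exact/bopP/bop_add.
  by have := Kl 1 _ _ (hS _ Kx) (hS' _ Kx); rewrite scale1r.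
- move=> c S [/bopP bS hS]; split=> [|x Kx]; first exact/bopP/bop_scale.
  by have := Kl c _ _ (hS _ Kx) K0; rewrite addr0.
- move=> S S' [/bopP bS hS] [/bopP bS' hS']; split=> [|x Kx]; first exact/bopP/bop_comp.
  by apply: hS; exact: hS'.
Qed.

Theorem theorem5p14 (R : realType) (H : completeNormedModType R[i])
    (ip : {dot H for Num.conj}) (M : set (H -> H))
    (tau : (H -> H) -> R[i]) (xi : H)
    (emb : bool -> 'M[R[i]]_2 -> H -> H)
    (hM : free_product_M2 ip M tau xi emb) :
  let E i j := emb false (delta_mx i j) in
  let F i j := emb true (delta_mx i j) in
  let A3 := generated_algebra ([set E 0 0; F 0 1] `|` commutant M) in
  ~ transitive_algebra A3 /\
  forall r : R, 0 <= r <= 1 ->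
    exists P : H -> H,
      [/\ M P, is_projection ip P, tau P = r%:C & Lat ip A3 P].
Proof.
move=> E F A3.
have hn := fp_hilbert hM.
have bgen : [set E 0 0; F 0 1] `|` commutant M `<=` bounded_op.
  by move=> T [[->|->]|[]] //; apply: (star_bounded (fp_morphism hM _)).
have A3b T : A3 T -> bop T.
  move=> hT; apply/bopP.
  have := @generated_algebra_preserves _ _ _ setT bgen _ _ _ T hT.
  by case.
have main (r : R) : 0 < r < 1 -> exists P : H -> H,
    [/\ M P, is_projection ip P, tau P = r%:C & Lat ip A3 P].
  move=> hr; have [P [mP pP tP iP]] := invariant_projection hM hr.
  have [_ PP _] := pP; have bP := M_bop hM mP.
  exists P; split => //; first by rewrite (tauE hM mP).
  split => // T hT; apply/funext => x /=.
  have := @generated_algebra_preserves _ _ _ [set y | P y = y] bgen _ _ _ T hT.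
  case=> [||S y hS|_ h].
  - exact: lop0.
  - by move=> c y z /= hy hz; rewrite (bop_linear bP) hy hz.
  - by apply: iP; case: hS => [[->|->]|]; [left|right; left|right; right].
  - by apply: h; have := congr1 (fun f => f x) PP.
split; last first.
  (* The weights exist only for 0 < t < 1; at the end points the projections 0 and 1 serve. *)
  move=> r /andP[]; rewrite le_eqVlt => /orP[/eqP <- _|r0].
    have m0 : M (fun=> 0).
      by have := M_sub hM (M_id hM) (M_id hM); congr M; apply/funext => x; rewrite subrr.
    have p0 : is_projection ip (fun=> 0).
      split; [exact/bopP/(M_bop hM m0)|by apply/funext|].
      by move=> x y; rewrite ip0l ip0r.
    exists (fun=> 0); split => //; first by rewrite (tauE hM m0) /tr ip0l.
    by split => // T hT; apply/funext => x /=; rewrite (lop0 (A3b _ hT)).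
  rewrite le_eqVlt => /orP[/eqP ->|r1]; last by apply: main; rewrite r0.
  have m1 := M_id hM.
  have p1 : is_projection ip idfun by split; [exact/bopP/bop_id| |].
  by exists idfun; split => //; rewrite (tauE hM m1) /tr /= (xi1 hM).
(* Trace 1/2 separates the range of the projection from both 0 and H, on testing at [xi]. *)
case=> _ htr; have h2 : 0 < (2^-1 : R) < 1 by lra.
have [P [mP pP tP [_ lP]]] := main _ h2.
have bP := M_bop hM mP; rewrite (tauE hM mP) in tP.
have [_ PP _] := pP; have PPx x : P (P x) = P x := congr1 (fun f => f x) PP.
have [|T x hT Px|K0|K1] := htr [set x | P x = x].
- split => /=; first last.
  + by move=> c x y hx hy; rewrite (bop_linear bP) hx hy.
  + exact: lop0.
  move=> x clx; apply/eqP; rewrite -subr_eq0; apply/eqP/nrm_eq0/eqP.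
  rewrite eq_le nrm_ge0 andbT; apply/ler_addgt0Pr => e e0; rewrite add0r.
  have [_ [c [c0 hc]]] := bP.
  have d0 : 0 < e / (c + 1) by rewrite divr_gt0// ltr_wpDl.
  have d0' : (0 : R[i]) < (e / (c + 1))%:C by rewrite ltcR.
  have [y [/= Py]] := clx _ (nbhsx_ballx x _ d0').
  rewrite -ball_normE /= nrmE ltcR ltr_pdivlMr ?ltr_wpDl// => hxy.
  have -> : P x - x = P (x - y) + (y - x) by rewrite (lopB bP) Py addrA subrK.
  have := nrmD (P (x - y)) (y - x); have := hc (x - y); rewrite (nrmBC y).
  by have := nrm_ge0 (x - y); lra.
- by rewrite /= -{1}Px; have := congr1 (fun f => f x) (lP T hT); rewrite /= Px.
- have Pxi : P xi = 0.
    have : [set x | P x = x] (P xi) by rewrite /= PPx.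
    by rewrite K0.
  move: tP; rewrite /tr Pxi ip0l => /esym /complexI.
  by lra.
- have Pxi : P xi = xi by have : [set x | P x = x] xi by rewrite K1.
  move: tP; rewrite /tr Pxi (xi1 hM) => /esym /complexI.
  by lra.
Qed.
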